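(* For outcomes $X,Y$, let $S(X,Y)$ denote the set of outcomes $o(\mathcal{G}\cup\mathcal{G}')$ over all pairs of achievement positional games $\mathcal{G},\mathcal{G}'$ with disjoint vertex sets, $o(\mathcal{G})=X$ and $o(\mathcal{G}')=Y$. Then $S(X,Y)=S(Y,X)$ and: $S(\mathcal{L},\mathcal{L})=\{\mathcal{L}\}$; $S(\mathcal{L},\mathcal{L}^-)=\{\mathcal{L}\}$; $S(\mathcal{L},\mathcal{N})=\{\mathcal{L},\mathcal{L}^-,\mathcal{N}\}$; $S(\mathcal{L},\mathcal{D})=\{\mathcal{L}\}$; $S(\mathcal{L},\mathcal{R}^-)=\{\mathcal{L},\mathcal{L}^-,\mathcal{N}\}$; $S(\mathcal{L},\mathcal{R})=\{\mathcal{L},\mathcal{L}^-,\mathcal{N},\mathcal{R}^-,\mathcal{R}\}$; $S(\mathcal{L}^-,\mathcal{L}^-)=\{\mathcal{L},\mathcal{L}^-\}$; $S(\mathcal{L}^-,\mathcal{N})=\{\mathcal{L},\mathcal{L}^-,\mathcal{N}\}$; $S(\mathcal{L}^-,\mathcal{D})=\{\mathcal{L}^-\}$; $S(\mathcal{L}^-,\mathcal{R}^-)=\{\mathcal{L}^-,\mathcal{N},\mathcal{R}^-\}$; $S(\mathcal{L}^-,\mathcal{R})=\{\mathcal{N},\mathcal{R}^-,\mathcal{R}\}$; $S(\mathcal{N},\mathcal{N})=\{\mathcal{L},\mathcal{L}^-,\mathcal{N},\mathcal{R}^-,\mathcal{R}\}$; $S(\mathcal{N},\mathcal{D})=\{\mathcal{N}\}$;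 $S(\mathcal{N},\mathcal{R}^-)=\{\mathcal{N},\mathcal{R}^-,\mathcal{R}\}$; $S(\mathcal{N},\mathcal{R})=\{\mathcal{N},\mathcal{R}^-,\mathcal{R}\}$; $S(\mathcal{D},\mathcal{D})=\{\mathcal{D}\}$; $S(\mathcal{D},\mathcal{R}^-)=\{\mathcal{R}^-\}$; $S(\mathcal{D},\mathcal{R})=\{\mathcal{R}\}$; $S(\mathcal{R}^-,\mathcal{R}^-)=\{\mathcal{R}^-,\mathcal{R}\}$; $S(\mathcal{R}^-,\mathcal{R})=\{\mathcal{R}\}$; $S(\mathcal{R},\mathcal{R})=\{\mathcal{R}\}$.
   Context: A hypergraph is a pair $(V,E)$ with $V$ finite and $E\subseteq 2^V\setminus\{\varnothing\}$. An achievement positional game is a triple $\mathcal{G}=(V,E_L,E_R)$ where $(V,E_L)$ and $(V,E_R)$ are hypergraphs; elements of $E_L$ are blue edges, elements of $E_R$ are red edges. Two players, Left and Right, alternately pick a previously unpicked vertex of $V$ (either player may be designated to start). A player fills an edge when they have picked all its vertices. If Left fills a blue edge before Right fills a red edge, Left wins; if Right fills a red edge before Left fills a blue edge, Right wins; if neither happens before all vertices are picked, the game is a draw. The disjoint union of games with disjoint vertex sets is $\mathcal{G}\cup\mathcal{G}'=(V\cup V',E_L\cup E'_L,E_R\cup E'_R)$. The outcome $o(\mathcal{G})$ is the pair (result under optimal play when Left starts, result under optimal play when Right starts), and it is one of six values: $\mathcal{L}$ = (Left wins, Left wins); $\mathcal{L}^-$ = (Left wins, draw); $\mathcal{N}$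 = (Left wins, Right wins); $\mathcal{D}$ = (draw, draw); $\mathcal{R}^-$ = (draw, Right wins); $\mathcal{R}$ = (Right wins, Right wins). *)

(* Defs.v *)
From mathcomp Require Import all_boot.
Set Implicit Arguments.
Unset Strict Implicit.
Unset Printing Implicit Defensive.

(* An achievement positional game on the finite vertex set T:
   blue edges (Left's) and red edges (Right's). *)
Record apg (T : finType) := APG {
  blue : {set {set T}};
  red  : {set {set T}}
}.

Definition wf_apg (T : finType) (G : apg T) : bool :=
  (set0 \notin blue G) && (set0 \notin red G).

Inductive result := RightWins | Draw | LeftWins.

Definition result_of_score (n : nat) : result :=
  match n with 0 => RightWins | 1 => Draw | _ => LeftWins end.

(* Minimax value of a position: A = vertices picked by Left, B = vertices
   picked by Right, lt = true iff it is Left's turn.  The fill conditions are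
   checked after every move, so at most one player has filled an edge at any
   reachable position; the first to fill wins.  Left maximizes, Right
   minimizes.  The fuel is the number of free vertices (initially #|T|). *)
Fixpoint score (T : finType) (G : apg T) (fuel : nat) (A B : {set T}) (lt : bool)
    {struct fuel} : nat :=
  if [exists e in blue G, e \subset A] then 2
  else if [exists e in red G, e \subset B] then 0
  else if [set: T] \subset A :|: B then 1
  else match fuel with
       | 0 => 1
       | f.+1 =>
         if lt then \max_(v : T | v \notin A :|: B) score G f (v |: A) B false
         else \big[minn/2]_(v : T | v \notin A :|: B) score G f A (v |: B) true
       end.

Definition play_result (T : finType) (G : apg T) (leftStarts : bool) : result :=
  result_of_score (score G #|T| set0 set0 leftStarts).

Definition outcome := (result * result)%type.

Definition o (T : finType) (G : apg T) : outcome :=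
  (play_result G true, play_result G false).

Definition oL  : outcome := (LeftWins, LeftWins).
Definition oLm : outcome := (LeftWins, Draw).
Definition oN  : outcome := (LeftWins, RightWins).
Definition oD  : outcome := (Draw, Draw).
Definition oRm : outcome := (Draw, RightWins).
Definition oR  : outcome := (RightWins, RightWins).

Definition gunion (T1 T2 : finType) (G1 : apg T1) (G2 : apg T2) : apg (T1 + T2)%type :=
  APG ([set (@inl T1 T2) @: (e : {set T1}) | e in blue G1] :|: [set (@inr T1 T2) @: (e : {set T2}) | e in blue G2])
      ([set (@inl T1 T2) @: (e : {set T1}) | e in red G1] :|: [set (@inr T1 T2) @: (e : {set T2}) | e in red G2]).

Definition S (X Y Z : outcome) : Prop :=
  exists (T1 T2 : finType) (G1 : apg T1) (G2 : apg T2),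
    [/\ wf_apg G1, wf_apg G2, o G1 = X, o G2 = Y & o (gunion G1 G2) = Z].

(* Main.v *)
Require Import Defs.
From HB Require Import structures.
From mathcomp Require Import all_boot zify.

(* Score a game 0, 1, 2 from Left's point of view.  Answering in the component
   where the opponent has just played, and strategy stealing when that component
   is full, give every inclusion except one: a union of non-draws is never a
   draw (this matters for L + R, L- + R- and N + N).

   For that, write P <= 0 if Left does not win P moving first and P >= 0 if
   Right does not win P moving first, so that draws are the games equal to 0.
   As in combinatorial game theory, a + h' <= 0, a' + h <= 0 and a' + h' >= 0
   imply a + h <= 0.  Suppose p + q = 0 is a minimal draw in which Left, moving
   first, wins p.  Her irreversible winning moves g of p are answered in q, by
   an irreversible h with g + h <= 0, and h is answered in p by some g' with
   g' + h >= 0; hence g <= g'.  Choosing g maximal forces g + h = 0, a smaller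
   draw in which g is still winning for Left: contradiction.

   The outcomes allowed by these rules are realized by explicit unions.  In the
   typical hard one, with outcome L-, Right opens by attacking Left's component, and
   Left has to let it go and destroy Right's component in return: defending
   would leave her with a win too slow for the race. *)

Set Implicit Arguments.
Unset Strict Implicit.
Unset Printing Implicit Defensive.

(** * Values of positions in a single game *)

Lemma leq_bigmin (I : eqType) (r : seq I) (P : pred I) (F : I -> nat) m k :
  (k <= \big[minn/m]_(i <- r | P i) F i) =
  (k <= m) && all (fun i => P i ==> (k <= F i)) r.
Proof.
elim: r => [|i r IHr]; first by rewrite big_nil andbT.
rewrite big_cons /=; case: (P i) => //=.
by rewrite leq_min IHr andbCA.
Qed.

Section Value.

Variables (T : finType) (G : apg T).
Implicit Types (A B : {set T}) (k f : nat) (lt : bool).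

Definition blue_filled A := [exists e in blue G, e \subset A].
Definition red_filled B := [exists e in red G, e \subset B].
Definition free A B : {set T} := ~: (A :|: B).
(** Tying the fuel to the number of free vertices makes the value a function of the position
    alone. *)
Definition value A B lt := score G #|free A B| A B lt.

Lemma blue_filledS A A' : A \subset A' -> blue_filled A -> blue_filled A'.
Proof.
move=> sAA' /existsP[e /andP[eE eA]]; apply/existsP; exists e.
by rewrite eE (subset_trans eA).
Qed.

Lemma red_filledS B B' : B \subset B' -> red_filled B -> red_filled B'.
Proof.
move=> sBB' /existsP[e /andP[eE eB]]; apply/existsP; exists e.
by rewrite eE (subset_trans eB).
Qed.

Lemma freeE A B v : (v \in free A B) = (v \notin A :|: B).
Proof. by rewrite in_setC. Qed.

Lemma free_notin A B v : v \in free A B -> (v \notin A) * (v \notin B).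
Proof. by rewrite freeE in_setU negb_or => /andP[-> ->]. Qed.

Lemma notin_free A B v : (v \notin free A B) = (v \in A) || (v \in B).
Proof. by rewrite freeE negbK inE. Qed.

Lemma full_free A B : ([set: T] \subset A :|: B) = (#|free A B| == 0).
Proof.
rewrite cards_eq0 /free subTset; apply/eqP/eqP => [->|fS]; first by rewrite setCT.
by rewrite -[LHS]setCK fS setC0.
Qed.

Lemma free_left A B v : free (v |: A) B = free A B :\ v.
Proof. by rewrite /free -setUA setCU setIC -setDE. Qed.

Lemma free_right A B v : free A (v |: B) = free A B :\ v.
Proof. by rewrite /free setUCA setCU setIC -setDE. Qed.

Lemma card_free_left A B v : v \in free A B -> #|free A B| = #|free (v |: A) B|.+1.
Proof. by move=> vF; rewrite free_left (cardsD1 v) vF. Qed.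

Lemma card_free_right A B v : v \in free A B -> #|free A B| = #|free A (v |: B)|.+1.
Proof. by move=> vF; rewrite free_right (cardsD1 v) vF. Qed.

Lemma scoreE f A B lt : #|free A B| <= f ->
  score G f A B lt =
  if blue_filled A then 2 else if red_filled B then 0
  else if #|free A B| == 0 then 1
  else if lt then \max_(v | v \in free A B) score G f.-1 (v |: A) B false
  else \big[minn/2]_(v | v \in free A B) score G f.-1 A (v |: B) true.
Proof.
case: f => [|f]; rewrite /= -/(blue_filled A) -/(red_filled B) full_free.
  by rewrite leqn0 => ->.
do 3 case: ifP => // _.
by case: lt => _; apply: eq_bigl => v; rewrite freeE.
Qed.

Lemma score_fuel f g A B lt : #|free A B| <= f -> #|free A B| <= g ->
  score G f A B lt = score G g A B lt.
Proof.
elim: f g A B lt => [|f IHf] g A B lt lef leg; rewrite !scoreE //.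
  by move: lef; rewrite leqn0 => ->.
case: eqP => // _; do 2 case: ifP => // _.
case: lt; apply: eq_bigr => v vF; apply: IHf => //=.
- by move: lef; rewrite (card_free_left vF).
- by move: leg; rewrite (card_free_left vF); case: g.
- by move: lef; rewrite (card_free_right vF).
- by move: leg; rewrite (card_free_right vF); case: g.
Qed.

Lemma valueE A B lt :
  value A B lt =
  if blue_filled A then 2 else if red_filled B then 0
  else if #|free A B| == 0 then 1
  else if lt then \max_(v | v \in free A B) value (v |: A) B false
  else \big[minn/2]_(v | v \in free A B) value A (v |: B) true.
Proof.
rewrite /value scoreE //; case: eqP => // _; do 2 case: ifP => // _.
case: lt; apply: eq_bigr => v vF.
  by apply: score_fuel => //; rewrite (card_free_left vF).
by apply: score_fuel => //; rewrite (card_free_right vF).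
Qed.

Lemma value_le2 A B lt : value A B lt <= 2.
Proof.
have [n] := ubnP #|free A B|; elim: n A B lt => // n IHn A B lt /ltnSE ltn.
rewrite valueE; do 3 case: ifP => // _; case: lt.
  by apply/bigmax_leqP => v vF; apply: IHn; rewrite -(card_free_left vF).
elim/big_ind: _ => [//|x y x2 _|v vF]; first by rewrite geq_min x2.
by apply: IHn; rewrite -(card_free_right vF).
Qed.

(** One move is unfolded for both thresholds at once: [k = 1] means that Left does not lose, [k = 2]
    that she wins. A full board without filled edges is a draw and meets only [k = 1]. *)
Lemma geL k A B : 0 < k <= 2 ->
  reflect
    (blue_filled A \/ ~~ red_filled B /\
      (#|free A B| = 0 /\ k = 1 \/
       exists2 v, v \in free A B & k <= value (v |: A) B false))
    (k <= value A B true).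
Proof.
case/andP=> k0 k2; rewrite valueE.
case: ifP => _; first by rewrite k2; constructor; left.
case: ifP => _ /=.
  by rewrite leqNgt k0; constructor; case=> // -[].
case: eqP => [f0|f0].
  apply: (iffP idP) => [k1|[//|[_ [[_ ->] //|[v vF]]]]]; last first.
    by move: vF; rewrite (cards0_eq f0) inE.
  by right; split=> //; left; split=> //; lia.
apply: (iffP idP) => [|[//|[_ [[//]|[v vF kv]]]]]; last first.
  by apply: (bigmax_sup v).
move=> km; right; split=> //; right.
case: (pickP [pred v in free A B | k <= value (v |: A) B false]) => [v /andP[]|no].
  by exists v.
move: km; rewrite leqNgt => /negP[]; rewrite -(prednK k0) ltnS.
apply/bigmax_leqP => v vF; rewrite -ltnS (prednK k0) ltnNge.
by have := no v; rewrite inE vF /= => ->.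
Qed.

Lemma geR k A B : 0 < k <= 2 ->
  reflect
    (blue_filled A \/ ~~ red_filled B /\
      (#|free A B| = 0 -> k = 1) /\
      (forall v, v \in free A B -> k <= value A (v |: B) true))
    (k <= value A B false).
Proof.
case/andP=> k0 k2; rewrite valueE.
case: ifP => _; first by rewrite k2; constructor; left.
case: ifP => _ /=.
  by rewrite leqNgt k0; constructor; case=> // -[].
case: eqP => [f0|f0].
  apply: (iffP idP) => [k1|[//|[_ [/(_ f0) -> //]]]].
  by right; split=> //; split=> [_|v]; [lia | rewrite (cards0_eq f0) inE].
rewrite leq_bigmin k2; apply: (iffP allP) => [al|[//|[_ [_ al]]] v _]; last first.
  by apply/implyP; apply: al.
by right; split=> //; split=> // v vF; have /implyP -> := al v (mem_index_enum v).
Qed.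

Lemma geL_free k A B v : 0 < k <= 2 -> ~~ red_filled B -> v \in free A B ->
  k <= value (v |: A) B false -> k <= value A B true.
Proof. by move=> k12 rB vF kv; apply/geL => //; right; split=> //; right; exists v. Qed.

(* Strategy stealing: extra vertices never hurt their owner, wherever they come
   from (free in the old position, or taken from the opponent). *)
Lemma value_mono A A' B B' lt : A \subset A' -> B' \subset B ->
  value A B lt <= value A' B' lt.
Proof.
move=> sA sB; suff mono k : 0 < k <= 2 -> k <= value A B lt -> k <= value A' B' lt.
  by have := value_le2 A B lt; case E: (value A B lt) => [//|[|[|]]] // _; apply: mono; rewrite ?E.
(* The positions may have different numbers of free vertices, and a stage may advance only one of
   them; hence the sum. *)
move=> k12; have [n] := ubnP (#|free A B| + #|free A' B'|).
elim: n A A' B B' sA sB lt => // n IHn A A' B B' sA sB lt /ltnSE ltn.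
have IH A1 A2 B1 B2 t : A1 \subset A2 -> B2 \subset B1 ->
    #|free A1 B1| + #|free A2 B2| < #|free A B| + #|free A' B'| ->
    k <= value A1 B1 t -> k <= value A2 B2 t.
  by move=> s1 s2 lt1; apply: IHn => //; apply: leq_trans lt1 ltn.
have [lwA' _|lwA'] := boolP (blue_filled A').
  by case: lt; [apply/geL|apply/geR] => //; left.
have full0 A1 B1 v : v \in free A1 B1 -> #|free A1 B1| <> 0.
  by move=> /card_free_left->.
have rS : ~~ red_filled B -> ~~ red_filled B' by apply/contra/red_filledS.
case: lt.
- case/(geL _ _ k12) => [/(blue_filledS sA)|]; first by rewrite (negPf lwA').
  case=> rB ex; have rB' := rS rB.
  have [E|/set0Pn[u uF]] := eqVneq (free A' B') set0.
    apply/geL=> //; right; split=> //; left; rewrite E cards0; split=> //.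
    case: ex => [[]//|[v vF kv]].
    have : k <= value A' B' false.
      apply: IH kv => //; last by rewrite (card_free_left vF) ltn_add2r.
      rewrite subUset sA andbT sub1set; have [_ vB] := free_notin vF.
      have := notin_free A' B' v; rewrite E inE /= => /esym/orP[//|/(subsetP sB)].
      by rewrite (negPf vB).
    case/(geR _ _ k12) => [|[_ [+ _]]]; first by rewrite (negPf lwA').
    by apply; rewrite E cards0.
  have next v A1 : k <= value A1 B false -> A1 \subset v |: A' -> v \in free A' B' ->
      #|free A1 B| <= #|free A B| -> k <= value A' B' true.
    move=> k1 s1 vF le1; apply: (geL_free k12 rB' vF); apply: IH k1 => //.
    by rewrite (card_free_left vF) addnS ltnS leq_add2r.
  case: ex => [[f0 k1]|[v vF kv]].
    apply: (next u A); rewrite ?(subset_trans sA) ?subsetUr //.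
    by apply/geR => //; right; split=> //; split=> // v /full0.
  (* If [v] is not free in the better position, it already belongs to Left there, and she plays any
     free [u] instead. *)
  have [vF'|vF'] := boolP (v \in free A' B').
    by apply: (next v (v |: A)); rewrite ?setUS // (card_free_left vF).
  apply: (next u (v |: A)); rewrite // ?(card_free_left vF) //.
  rewrite subUset (subset_trans sA) ?subsetUr // andbT sub1set inE.
  move: vF'; rewrite notin_free => /orP[->|/(subsetP sB)]; first by rewrite orbT.
  by rewrite (negPf (free_notin vF).2).
case/(geR _ _ k12) => [/(blue_filledS sA)|]; first by rewrite (negPf lwA').
case=> rB [fk al]; apply/geR => //; right; split; first exact: rS.
have [E|/set0Pn[u uF]] := eqVneq (free A B) set0.
  have kA : k <= value A B true.
    by apply/geL => //; right; split=> //; left; rewrite fk E cards0.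
  have k1 : k = 1 by rewrite fk // E cards0.
  split=> // v vF; apply: IH kA => //; last first.
    by rewrite (card_free_right vF) addnS.
  rewrite subUset sB andbT sub1set; have [vA _] := free_notin vF.
  have := notin_free A B v; rewrite E inE /= => /esym/orP[/(subsetP sA)|//].
  by rewrite (negPf vA).
split=> [f0|v vF].
  have : k <= value A' B' true.
    apply: IH (al u uF); rewrite // ?(subset_trans sB) ?subsetUr //.
    by rewrite (card_free_right uF) ltn_add2r.
  case/(geL _ _ k12) => [|[_ [[]//|[v /full0//]]]].
  by rewrite (negPf lwA').
(* If [v] is not free in the old position, Right already owns it there, so he is given an arbitrary
   free [u] in exchange. *)
have [vF'|vF'] := boolP (v \in free A B).
  apply: IH (al v vF'); rewrite ?setUS //.
  by rewrite (card_free_right vF) (card_free_right vF') addnS !addSn ltnS leqW.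
apply: IH (al u uF) => //.
  rewrite subUset (subset_trans sB) ?subsetUr // andbT sub1set inE.
  move: vF'; rewrite notin_free => /orP[/(subsetP sA)|->]; last by rewrite orbT.
  by rewrite (negPf (free_notin vF).1).
by rewrite (card_free_right vF) (card_free_right uF) addnS !addSn ltnS leqW.
Qed.

(** Left plays any free vertex and then acts as if she had not moved: by [value_mono] the extra
    vertex does no harm. *)
Lemma value_first A B : value A B false <= value A B true.
Proof.
suff le k : 0 < k <= 2 -> k <= value A B false -> k <= value A B true.
  by have := value_le2 A B false; case E: (value A B false) => [//|[|[|]]] // _; apply: le; rewrite ?E.
move=> k12 /(geR _ _ k12) kF; apply/geL => //.
case: kF => [|[rB [fk al]]]; [by left|right; split=> //].
have [E|/set0Pn[u uF]] := eqVneq (free A B) set0.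
  by left; rewrite fk E cards0.
right; exists u => //; apply: leq_trans (_ : value A B false <= _).
  by apply/geR => //; right; split.
by apply: value_mono; rewrite ?subsetUr.
Qed.

End Value.

(** * Symmetries: exchanging the colours and relabelling the vertices *)

HB.instance Definition _ := SemiGroup.isComLaw.Build nat minn minnA minnC.

Definition swap (T : finType) (G : apg T) : apg T := APG (red G) (blue G).

(** The score tests blue edges first, so the symmetry would fail where both players have filled an
    edge. The exclusion is inherited by successors, because play stops as soon as one edge is
    filled. *)
Lemma value_swap (T : finType) (G : apg T) (A B : {set T}) lt :
  ~~ (blue_filled G A && red_filled G B) ->
  value (swap G) B A (~~ lt) = 2 - value G A B lt.
Proof.
have [n] := ubnP #|free A B|; elim: n A B lt => // n IHn A B lt /ltnSE ltn.
have fC : free B A = free A B by rewrite /free setUC.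
rewrite !valueE fC -[blue_filled (swap G) B]/(red_filled G B).
rewrite -[red_filled (swap G) A]/(blue_filled G A).
case lA: (blue_filled G A); case rB: (red_filled G B) => //= _.
case: ifP => // f0.
have step v t : v \in free A B ->
   (value (swap G) B (v |: A) (~~ t) = 2 - value G (v |: A) B t) *
   (value (swap G) (v |: B) A (~~ t) = 2 - value G A (v |: B) t).
  move=> vF; split; apply: IHn; rewrite ?rB ?andbF ?lA //.
    by rewrite -(card_free_left vF).
  by rewrite -(card_free_right vF).
case: lt => /=.
  rewrite (big_morph (subn 2) (id1 := 2) (op1 := minn)) //; last by move=> x y; lia.
  by apply: eq_bigr => v vF; rewrite -(step v false).
rewrite (big_morph (subn 2) (id1 := 0) (op1 := maxn)) //; last by move=> x y; lia.
by apply: eq_bigr => v vF; rewrite -(step v true).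
Qed.

Lemma value_bij (T T' : finType) (f : T -> T') (G : apg T) (G' : apg T')
    (A B : {set T}) lt :
  bijective f ->
  blue G' = [set f @: (e : {set T}) | e in blue G] ->
  red G' = [set f @: (e : {set T}) | e in red G] ->
  value G' (f @: A) (f @: B) lt = value G A B lt.
Proof.
move=> bij_f eqb eqr; have inj_f := bij_inj bij_f.
have sub (C D : {set T}) : (f @: C \subset f @: D) = (C \subset D).
  apply/idP/idP => [sCD|]; last exact: imsetS.
  apply/subsetP => x xC; have := subsetP sCD (f x); rewrite !mem_imset //; exact.
have bE (C : {set T}) : blue_filled G' (f @: C) = blue_filled G C.
  rewrite /blue_filled eqb; apply/existsP/existsP => [[_ /andP[/imsetP[e eG ->]]]|[e /andP[eG eC]]].
    by rewrite sub => eC; exists e; rewrite eG.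
  by exists (f @: e); rewrite imset_f // sub.
have rE (C : {set T}) : red_filled G' (f @: C) = red_filled G C.
  rewrite /red_filled eqr; apply/existsP/existsP => [[_ /andP[/imsetP[e eG ->]]]|[e /andP[eG eC]]].
    by rewrite sub => eC; exists e; rewrite eG.
  by exists (f @: e); rewrite imset_f // sub.
have fE (C D : {set T}) : free (f @: C) (f @: D) = f @: free C D.
  case: bij_f => g fK gK; apply/setP => y; rewrite -[y]gK.
  by rewrite (mem_imset _ _ inj_f) !inE !(mem_imset _ _ inj_f).
have [n] := ubnP #|free A B|; elim: n A B lt => // n IHn A B lt /ltnSE ltn.
rewrite [LHS]valueE [RHS]valueE bE rE fE (card_imset _ inj_f).
do 3 case: ifP => // _.
(* The default [2] is not neutral for [minn] on all naturals, so reindexing the minimum relies on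
   [minn] as a commutative semigroup law. *)
case: lt; rewrite (reindex f) /=; try exact: onW_bij.
  apply: eq_big => [v|v]; rewrite (mem_imset _ _ inj_f) // => vF.
  rewrite -IHn ?imsetU1 //; by rewrite -(card_free_left vF).
apply: eq_big => [v|v]; rewrite (mem_imset _ _ inj_f) // => vF.
by rewrite -IHn ?imsetU1 //; rewrite -(card_free_right vF).
Qed.

(** * Vertex sets and filled edges in a disjoint union *)

Section Join.

Variables T1 T2 : finType.
Implicit Types (A B : {set T1}) (C D : {set T2}).

Definition join A C : {set T1 + T2} := (@inl T1 T2) @: A :|: (@inr T1 T2) @: C.

Lemma inl_inj : injective (@inl T1 T2). Proof. by move=> x y []. Qed.
Lemma inr_inj : injective (@inr T1 T2). Proof. by move=> x y []. Qed.

Lemma in_joinl A C x : (inl x \in join A C) = (x \in A).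
Proof.
rewrite inE (mem_imset _ _ inl_inj); case: (x \in A) => //=.
by apply/imsetP => -[].
Qed.

Lemma in_joinr A C x : (inr x \in join A C) = (x \in C).
Proof.
rewrite inE (mem_imset _ _ inr_inj) orbC; case: (x \in C) => //=.
by apply/imsetP => -[].
Qed.

Lemma join0 : join set0 set0 = set0.
Proof. by rewrite /join !imset0 setU0. Qed.

Lemma join_addl A C x : inl x |: join A C = join (x |: A) C.
Proof. by rewrite /join imsetU1 setUA. Qed.

Lemma join_addr A C x : inr x |: join A C = join A (x |: C).
Proof. by rewrite /join imsetU1 setUCA. Qed.

Lemma free_join A B C D : free (join A C) (join B D) = join (free A B) (free C D).
Proof.
by apply/setP => -[] x; rewrite freeE in_setU ?in_joinl ?in_joinr freeE in_setU.
Qed.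

Lemma card_join A C : #|join A C| = #|A| + #|C|.
Proof.
rewrite cardsU !card_imset; [|exact: inr_inj|exact: inl_inj].
rewrite (_ : _ :&: _ = set0) ?cards0 ?subn0 //.
by apply/setP => x; rewrite !inE; apply/andP => -[/imsetP[y _ ->] /imsetP[]].
Qed.

Lemma joinS_inl A C (e : {set T1}) : ((@inl T1 T2) @: e \subset join A C) = (e \subset A).
Proof.
apply/subsetP/subsetP => s x xe.
  by rewrite -(in_joinl _ C); apply: s; rewrite imset_f.
by case/imsetP: xe => y ye ->; rewrite in_joinl s.
Qed.

Lemma joinS_inr A C (e : {set T2}) : ((@inr T1 T2) @: e \subset join A C) = (e \subset C).
Proof.
apply/subsetP/subsetP => s x xe.
  by rewrite -(in_joinr A); apply: s; rewrite imset_f.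
by case/imsetP: xe => y ye ->; rewrite in_joinr s.
Qed.

End Join.

Section Union.

Variables (T1 T2 : finType) (G1 : apg T1) (G2 : apg T2).
Implicit Types (A B : {set T1}) (C D : {set T2}).

Local Notation U := (gunion G1 G2).

Lemma blue_filledU A C :
  blue_filled U (join A C) = blue_filled G1 A || blue_filled G2 C.
Proof.
apply/existsP/orP => [[e /andP[]]|[]/existsP[e /andP[eG eA]]].
- case/setUP=> /imsetP[d dG ->]; rewrite ?joinS_inl ?joinS_inr => dA.
    by left; apply/existsP; exists d; rewrite dG.
  by right; apply/existsP; exists d; rewrite dG.
- by exists ((@inl T1 T2) @: e); rewrite inE imset_f // joinS_inl.
- by exists ((@inr T1 T2) @: e); rewrite inE imset_f ?orbT // joinS_inr.
Qed.

Lemma red_filledU B D :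
  red_filled U (join B D) = red_filled G1 B || red_filled G2 D.
Proof.
apply/existsP/orP => [[e /andP[]]|[]/existsP[e /andP[eG eA]]].
- case/setUP=> /imsetP[d dG ->]; rewrite ?joinS_inl ?joinS_inr => dA.
    by left; apply/existsP; exists d; rewrite dG.
  by right; apply/existsP; exists d; rewrite dG.
- by exists ((@inl T1 T2) @: e); rewrite inE imset_f // joinS_inl.
- by exists ((@inr T1 T2) @: e); rewrite inE imset_f ?orbT // joinS_inr.
Qed.

End Union.

Definition sumC T1 T2 (x : T1 + T2) : T2 + T1 :=
  match x with inl y => inr y | inr y => inl y end.

Lemma sumC_bij T1 T2 : bijective (@sumC T1 T2).
Proof. by exists (@sumC T2 T1); case. Qed.

Lemma value_unionC (T1 T2 : finType) (G1 : apg T1) (G2 : apg T2)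
    (A B : {set T1}) (C D : {set T2}) lt :
  value (gunion G2 G1) (join C A) (join D B) lt =
  value (gunion G1 G2) (join A C) (join B D) lt.
Proof.
have im A' C' : join C' A' = (@sumC T1 T2) @: join A' C'.
  by rewrite /join imsetU -!imset_comp setUC.
rewrite 2!im; apply: value_bij; first exact: sumC_bij.
  rewrite /= imsetU -!imset_comp setUC; congr (_ :|: _);
    by apply: eq_imset => e /=; rewrite -imset_comp.
rewrite /= imsetU -!imset_comp setUC; congr (_ :|: _);
  by apply: eq_imset => e /=; rewrite -imset_comp.
Qed.

(** * Sums of positions: one-move criteria, lower bounds and the exchange inequality *)

Notation position T := ({set T} * {set T})%type.

Section Position.

Variables (T : finType) (G : apg T).
Implicit Type p : position T.

Definition addL p x : position T := (x |: p.1, p.2).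
Definition addR p x : position T := (p.1, x |: p.2).
Definition frees p := free p.1 p.2.
Definition valp p lt := value G p.1 p.2 lt.
Definition lwin p := blue_filled G p.1.
Definition rwin p := red_filled G p.2.

Lemma frees_addL p x : x \in frees p -> #|frees p| = #|frees (addL p x)|.+1.
Proof. exact: card_free_left. Qed.

Lemma frees_addR p x : x \in frees p -> #|frees p| = #|frees (addR p x)|.+1.
Proof. exact: card_free_right. Qed.

Lemma full_notin p x : #|frees p| = 0 -> x \in frees p = false.
Proof. by move/cards0_eq->; rewrite inE. Qed.

Lemma valp2R_notfull p : ~~ lwin p -> 2 <= valp p false -> 0 < #|frees p|.
Proof.
move=> lp /geR-/(_ isT)[|[_ [f _]]]; first by rewrite -/(lwin p) (negPf lp).
by rewrite lt0n; apply/eqP => /f.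
Qed.

End Position.

Section Sum.

Variables (T1 T2 : finType) (G1 : apg T1) (G2 : apg T2).
Implicit Types (p a g : position T1) (q h : position T2).

Definition valU p q lt :=
  value (gunion G1 G2) (join p.1 q.1) (join p.2 q.2) lt.

Local Notation lw p q := (lwin G1 p || lwin G2 q).
Local Notation rw p q := (rwin G1 p || rwin G2 q).

Lemma geLU k p q : 0 < k <= 2 ->
  reflect
    (lw p q \/ ~~ rw p q /\
      [\/ #|frees p| + #|frees q| = 0 /\ k = 1,
          exists2 v, v \in frees p & k <= valU (addL p v) q false
        | exists2 v, v \in frees q & k <= valU p (addL q v) false])
    (k <= valU p q true).
Proof.
move=> k12; apply: (iffP (geL _ _ _ k12)); rewrite blue_filledU red_filledU free_join card_join.
  case=> [|[rB ex]]; [by left|right; split=> //].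
  case: ex => [|[[v|v]]]; first by constructor 1.
    by rewrite in_joinl => vF; rewrite join_addl; constructor 2; exists v.
  by rewrite in_joinr => vF; rewrite join_addr; constructor 3; exists v.
case=> [|[rB ex]]; [by left|right; split=> //].
case: ex => [|[v vF kv]|[v vF kv]]; [by left|right; exists (inl v)|right; exists (inr v)].
- by rewrite in_joinl.
- by rewrite join_addl.
- by rewrite in_joinr.
- by rewrite join_addr.
Qed.

Lemma geRU k p q : 0 < k <= 2 ->
  reflect
    (lw p q \/ ~~ rw p q /\
      [/\ #|frees p| + #|frees q| = 0 -> k = 1,
          forall v, v \in frees p -> k <= valU (addR p v) q true
        & forall v, v \in frees q -> k <= valU p (addR q v) true])
    (k <= valU p q false).
Proof.
move=> k12; apply: (iffP (geR _ _ _ k12)); rewrite blue_filledU red_filledU free_join card_join.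
  case=> [|[rB [f al]]]; [by left|right; split=> //; split=> // v vF].
    by have := al (inl v); rewrite in_joinl join_addl; apply.
  by have := al (inr v); rewrite in_joinr join_addr; apply.
case=> [|[rB [f al1 al2]]]; [by left|right; split=> //; split=> // -[] v].
  by rewrite in_joinl join_addl; apply: al1.
by rewrite in_joinr join_addr; apply: al2.
Qed.

Lemma valU_first p q : valU p q false <= valU p q true.
Proof. exact: value_first. Qed.

(* Ln: Left does not win when she starts ("<= 0"); Rp: Right does not win when
   he starts (">= 0"); Rn and Lp are their options. *)
Local Notation Ln p q := (valU p q true <= 1).
Local Notation Rn p q := (valU p q false <= 1).
Local Notation Lp p q := (1 <= valU p q true).
Local Notation Rp p q := (1 <= valU p q false).

Lemma LnP p q :
  reflect (~~ lw p q /\ (rw p q \/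
             (forall v, v \in frees p -> Rn (addL p v) q) /\
             (forall v, v \in frees q -> Rn p (addL q v))))
          (Ln p q).
Proof.
rewrite leqNgt; apply: (iffP negP) => [no|[lF ex] /geLU-/(_ isT)[|[rF]]].
- have no' := no; split; first by apply/negP => lT; apply: no; apply/geLU => //; left.
  have [|rF] := boolP (rw p q); first by left.
  right; split=> v vF; rewrite leqNgt; apply/negP => v2; apply: no; apply/geLU => //;
    right; split=> //; [constructor 2|constructor 3]; by exists v.
- by rewrite (negPf lF).
- case: ex; first by rewrite (negPf rF).
  case=> al1 al2 [[]//|[v vF]|[v vF]]; rewrite ltnNge => /negP; apply.
    exact: al1.
  exact: al2.
Qed.

Lemma RnP p q :
  reflect (~~ lw p q /\ [\/ rw p q, #|frees p| + #|frees q| = 0,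
             exists2 v, v \in frees p & Ln (addR p v) q
           | exists2 v, v \in frees q & Ln p (addR q v)])
          (Rn p q).
Proof.
rewrite leqNgt; apply: (iffP negP) => [no|[lF ex] /geRU-/(_ isT)[|[rF [f al1 al2]]]].
- split; first by apply/negP => lT; apply: no; apply/geRU => //; left.
  have [|rF] := boolP (rw p q); first by constructor 1.
  have [f|f] := eqVneq (#|frees p| + #|frees q|) 0; first by constructor 2.
  have [/exists_inP[v]|/exists_inPn al1] := boolP [exists v in frees p, Ln (addR p v) q].
    by constructor 3; exists v.
  have [/exists_inP[v]|/exists_inPn al2] := boolP [exists v in frees q, Ln p (addR q v)].
    by constructor 4; exists v.
  case: no; apply/geRU => //; right; split=> //; split=> [fF|v vF|v vF].
  + by rewrite fF in f.
  + by rewrite ltnNge al1.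
  + by rewrite ltnNge al2.
- by rewrite (negPf lF).
- case: ex => [|/f//|[v vF]|[v vF]]; first by rewrite (negPf rF).
    by rewrite leqNgt al1.
  by rewrite leqNgt al2.
Qed.

Lemma LpP p q :
  reflect (lw p q \/ ~~ rw p q /\ [\/ #|frees p| + #|frees q| = 0,
             exists2 v, v \in frees p & Rp (addL p v) q
           | exists2 v, v \in frees q & Rp p (addL q v)])
          (Lp p q).
Proof.
apply: (iffP (@geLU 1 p q isT)) => -[|[rF ex]]; try by left.
  by right; split=> //; case: ex => [[]|ex|ex]; [constructor 1|constructor 2|constructor 3].
by right; split=> //; case: ex => [f|ex|ex]; [constructor 1|constructor 2|constructor 3].
Qed.

Lemma RpP p q :
  reflect (lw p q \/ ~~ rw p q /\
             (forall v, v \in frees p -> Lp (addR p v) q) /\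
             (forall v, v \in frees q -> Lp p (addR q v)))
          (Rp p q).
Proof.
apply: (iffP (@geRU 1 p q isT)) => -[|[rF]]; try by left.
  by case=> _ al1 al2; right.
by case=> al1 al2; right.
Qed.

(** Left follows a strategy in each component and answers where Right has just played. The three
    clauses, according to who starts where, are proved together because each move leads from one to
    another. *)
Lemma union_ge k p q : 0 < k <= 2 ->
  [/\ k <= valp G1 p false -> 1 <= valp G2 q false -> k <= valU p q false,
      k <= valp G1 p true -> 1 <= valp G2 q false -> k <= valU p q true
    & k <= valp G1 p false -> 1 <= valp G2 q true -> k <= valU p q true].
Proof.
move=> k12; have [n] := ubnP (#|frees p| + #|frees q|).
elim: n p q => // n IHn p q /ltnSE ltn.
have lwR : lw p q -> k <= valU p q false by move=> lT; apply/geRU => //; left.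
have lwL : lw p q -> k <= valU p q true by move=> lT; apply/geLU => //; left.
split.
- case/(geR _ _ _ k12) => [lp _|[rp [fp alp]]]; first by rewrite lwR // /lwin lp.
  case/(@geR _ _ 1 _ _ isT) => [lq|[rq [fq alq]]]; first by rewrite lwR // /lwin lq orbT.
  apply/geRU => //; right; split; first by rewrite negb_or rp.
  split=> [f|v vF|v vF].
  + by apply: fp; apply/eqP; rewrite -leqn0 -f leq_addr.
  + case: (IHn (addR p v) q) => [|_ + _].
      by apply: leq_trans ltn; rewrite (frees_addR vF).
    by apply; [apply: alp|apply/geR => //; right].
  + case: (IHn p (addR q v)) => [|_ _].
      by apply: leq_trans ltn; rewrite (frees_addR vF) addnS.
    by apply; [apply/geR => //; right|apply: alq].
- case/(geL _ _ _ k12) => [lp _|[rp ex]]; first by rewrite lwL // /lwin lp.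
  move=> q1; have := q1.
  case/(@geR _ _ 1 _ _ isT) => [lq|[rq [fq alq]]]; first by rewrite lwL // /lwin lq orbT.
  apply/geLU => //; right; split; first by rewrite negb_or rp.
  case: ex => [[fp k1]|[v vF kv]]; last first.
    constructor 2; exists v => //; case: (IHn (addL p v) q) => [|+ _ _].
      by apply: leq_trans ltn; rewrite (frees_addL vF).
    exact.
  (* The component where Left should move is full, which forces [k = 1]; she spends the move on any
     vertex of the other one, harmless by [value_mono]. *)
  have [E|/set0Pn[v vF]] := eqVneq (frees q) set0.
    by constructor 1; rewrite -/(frees p) in fp; rewrite fp E cards0.
  constructor 3; exists v => //; case: (IHn p (addL q v)) => [|+ _ _].
    by apply: leq_trans ltn; rewrite (frees_addL vF) addnS.
  apply; last by apply: leq_trans q1 _; apply: value_mono; rewrite ?subsetUr.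
  by apply/geR => //; right; split=> //; split=> // w; rewrite full_notin.
- move=> kp; have := kp.
  case/(geR _ _ _ k12) => [lp _|[rp [fp alp]]]; first by rewrite lwL // /lwin lp.
  case/(@geL _ _ 1 _ _ isT) => [lq|[rq ex]]; first by rewrite lwL // /lwin lq orbT.
  apply/geLU => //; right; split; first by rewrite negb_or rp.
  case: ex => [[fq _]|[v vF kv]]; last first.
    constructor 3; exists v => //; case: (IHn p (addL q v)) => [|+ _ _].
      by apply: leq_trans ltn; rewrite (frees_addL vF) addnS.
    exact.
  have [E|/set0Pn[v vF]] := eqVneq (frees p) set0.
    constructor 1; rewrite -/(frees q) in fq; rewrite fq E cards0; split=> //.
    by apply: fp; rewrite -/(frees p) E cards0.
  constructor 2; exists v => //; case: (IHn (addL p v) q) => [|+ _ _].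
    by apply: leq_trans ltn; rewrite (frees_addL vF).
  apply; first by apply: leq_trans kp _; apply: value_mono; rewrite ?subsetUr.
  by apply/geR => //; right; split=> //; split=> // w; rewrite full_notin.
Qed.

(* The statement wanted is the first one; in ordered-group notation it reads
   a + h <= (a + h) + (a' + h') = (a + h') + (a' + h) <= 0.
   Right plays a + h by running his strategies on a + h' and a' + h against
   Left's strategy on a' + h'; the other three statements are the stages of
   this internal dialogue, according to the sum in which a move is pending. *)
Lemma exchange_ind a a' h h' :
  [/\ Ln a h' -> Ln a' h -> Rp a' h' -> Ln a h,
      Rn a h' -> Ln a' h -> Rp a' h' -> Rn a h,
      Ln a h' -> Rn a' h -> Rp a' h' -> Rn a h
    & Ln a h' -> Ln a' h -> Lp a' h' -> Rn a h].
Proof.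
(* Each stage of the dialogue fills a vertex of one of the four positions. *)
have [n] := ubnP (#|frees a| + #|frees a'| + #|frees h| + #|frees h'|).
elim: n a a' h h' => // n IHn a a' h h' /ltnSE ltn.
have RnLn p q : Ln p q -> Rn p q by apply/leq_trans/valU_first.
have rwRn p q : ~~ lw p q -> rw p q -> Rn p q.
  by move=> lF rT; apply/RnP; split=> //; constructor 1.
have S0 : Ln a h' -> Ln a' h -> Rp a' h' -> Ln a h.
  case/LnP; rewrite negb_or => /andP[la lh'] al.
  case/LnP; rewrite negb_or => /andP[la' lh] al'.
  case/RpP => [|[]]; first by rewrite (negPf la') (negPf lh').
  rewrite negb_or => /andP[ra' rh'] [alR1 alR2].
  have Rah : Rp a' h' by apply/RpP; right; rewrite negb_or ra'.
  have Lah : Ln a h' by apply/LnP; rewrite negb_or la.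
  have Lah' : Ln a' h by apply/LnP; rewrite negb_or la'.
  apply/LnP; rewrite negb_or la lh; split=> //.
  have [|rF] := boolP (rw a h); [by left | right].
  move: rF; rewrite negb_or => /andP[ra rh].
  case: al => [|[al1 al2]]; first by rewrite (negPf ra) (negPf rh').
  case: al' => [|[al1' al2']]; first by rewrite (negPf ra') (negPf rh).
  (* Left's move in [a] is entered in [a + h'], her move in [h] in [a' + h]; Right's reply is then
     due in that sum. *)
  split=> v vF.
    case: (IHn (addL a v) a' h h') => [|_ + _ _]; last by apply=> //; apply: al1.
    by apply: leq_trans ltn; rewrite (frees_addL vF) !addSn.
  case: (IHn a a' (addL h v) h') => [|_ _ + _]; last by apply=> //; apply: al2'.
  by apply: leq_trans ltn; rewrite (frees_addL vF) addnS !addSn.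
split=> //.
- move=> Rah' Lah Rah; have [la' lh] : ~~ lwin G1 a' /\ ~~ lwin G2 h.
    by case/LnP: (Lah); rewrite negb_or => /andP.
  have [la lh'] : ~~ lwin G1 a /\ ~~ lwin G2 h'.
    by case/RnP: (Rah'); rewrite negb_or => /andP.
  case/RpP: (Rah) => [|[]]; first by rewrite (negPf la') (negPf lh').
  rewrite negb_or => /andP[ra' rh'] [alR1 alR2].
  have lah : ~~ lw a h by rewrite negb_or la.
  have [|rF] := boolP (rw a h); first exact: rwRn.
  move: (rF); rewrite negb_or => /andP[ra rh].
  case/RnP: Rah' => _; rewrite (negPf ra) (negPf rh').
  case=> [//|/eqP|[v vF Lv]|[v vF Lv]].
  + rewrite addn_eq0 => /andP[/eqP fa /eqP fh']; apply: RnLn; apply: S0 => //.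
    apply/LnP; rewrite negb_or la; split=> //; right.
    by split=> v; rewrite full_notin.
  (* A reply in [a] is a genuine move in [a + h]; a reply in [h'] is passed on to [a' + h'], where
     Left has to answer. *)
  + apply/RnP; split=> //; constructor 3; exists v => //.
    case: (IHn (addR a v) a' h h') => [|+ _ _ _]; last exact.
    by apply: leq_trans ltn; rewrite (frees_addR vF) !addSn.
  + case: (IHn a a' h (addR h' v)) => [|_ _ _]; last by apply=> //; apply: alR2.
    by apply: leq_trans ltn; rewrite (frees_addR vF) !addnS.
- move=> Lah' Rah' Rah; have [la lh'] : ~~ lwin G1 a /\ ~~ lwin G2 h'.
    by case/LnP: (Lah'); rewrite negb_or => /andP.
  have [la' lh] : ~~ lwin G1 a' /\ ~~ lwin G2 h.
    by case/RnP: (Rah'); rewrite negb_or => /andP.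
  case/RpP: (Rah) => [|[]]; first by rewrite (negPf la') (negPf lh').
  rewrite negb_or => /andP[ra' rh'] [alR1 alR2].
  have lah : ~~ lw a h by rewrite negb_or la.
  have [|rF] := boolP (rw a h); first exact: rwRn.
  move: (rF); rewrite negb_or => /andP[ra rh].
  case/RnP: Rah' => _; rewrite (negPf ra') (negPf rh).
  case=> [//|/eqP|[v vF Lv]|[v vF Lv]].
  + rewrite addn_eq0 => /andP[/eqP fa /eqP fh']; apply: RnLn; apply: S0 => //.
    apply/LnP; rewrite negb_or la'; split=> //; right.
    by split=> v; rewrite full_notin.
  + case: (IHn a (addR a' v) h h') => [|_ _ _]; last by apply=> //; apply: alR1.
    by apply: leq_trans ltn; rewrite (frees_addR vF) addnS !addSn.
  + apply/RnP; split=> //; constructor 4; exists v => //.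
    case: (IHn a a' (addR h v) h') => [|+ _ _ _]; last exact.
    by apply: leq_trans ltn; rewrite (frees_addR vF) addnS !addSn.
- move=> Lah' La'h Lah; case/LnP: (Lah'); rewrite negb_or => /andP[la lh'] al.
  case/LnP: (La'h); rewrite negb_or => /andP[la' lh] al'.
  have lah : ~~ lw a h by rewrite negb_or la.
  have [|rF] := boolP (rw a h); first exact: rwRn.
  move: (rF); rewrite negb_or => /andP[ra rh].
  case/LpP: Lah => [|[]]; first by rewrite (negPf la') (negPf lh').
  rewrite negb_or => /andP[ra' rh'].
  case: al => [|[al1 al2]]; first by rewrite (negPf ra) (negPf rh').
  case: al' => [|[al1' al2']]; first by rewrite (negPf ra') (negPf rh).
  case=> [/eqP|[v vF Rv]|[v vF Rv]].
  + rewrite addn_eq0 => /andP[/eqP fa /eqP fh']; apply: RnLn; apply: S0 => //.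
    apply/RpP; right; rewrite negb_or ra'; split=> //.
    by split=> v; rewrite full_notin.
  (* Left's answer in [a' + h'] becomes her move in [a' + h] or [a + h'], and Right's strategy there
     is consulted again. *)
  + case: (IHn a (addL a' v) h h') => [|_ _ + _]; last by apply=> //; apply: al1'.
    by apply: leq_trans ltn; rewrite (frees_addL vF) addnS !addSn.
  + case: (IHn a a' h (addL h' v)) => [|_ + _ _]; last by apply=> //; apply: al2.
    by apply: leq_trans ltn; rewrite (frees_addL vF) !addnS.
Qed.

Lemma exchange a a' h h' : Ln a h' -> Ln a' h -> Rp a' h' -> Ln a h.
Proof. by case: (exchange_ind a a' h h'). Qed.

End Sum.


(** * Interchange of the players in sums *)

Definition flip T (p : position T) : position T := (p.2, p.1).

Section Dual.

Variables (T1 T2 : finType) (G1 : apg T1) (G2 : apg T2).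
Implicit Types (p a g : position T1) (q h : position T2).

Local Notation lw p q := (lwin G1 p || lwin G2 q).

Lemma valp_flip p t : ~~ lwin G1 p ->
  valp (swap G1) (flip p) (~~ t) = 2 - valp G1 p t.
Proof. by move=> lF; apply: value_swap; rewrite negb_and [X in X || _]lF. Qed.

Lemma valU_flip p q t : ~~ lw p q ->
  valU (swap G1) (swap G2) (flip p) (flip q) (~~ t) = 2 - valU G1 G2 p q t.
Proof.
move=> lF; apply: (@value_swap _ (gunion G1 G2)).
by rewrite negb_and blue_filledU [X in X || _]lF.
Qed.

End Dual.

(** * A drawn union has drawn components *)

Section Draw.

Variables (T1 T2 : finType) (G1 : apg T1) (G2 : apg T2).
Implicit Types (p a g : position T1) (q h : position T2).

Local Notation lw p q := (lwin G1 p || lwin G2 q).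
Local Notation rw p q := (rwin G1 p || rwin G2 q).
Local Notation u := (valU G1 G2).
Local Notation Ln p q := (u p q true <= 1).
Local Notation Rn p q := (u p q false <= 1).
Local Notation Lp p q := (1 <= u p q true).
Local Notation Rp p q := (1 <= u p q false).

(** This is [exchange] for the interchanged players. A blue edge filled in [a] or [h], which the
    symmetry cannot handle, gives the conclusion at once. *)
Lemma exchange_dual a a' h h' : Rp a h' -> Rp a' h -> Ln a' h' -> Rp a h.
Proof.
move=> Rah' Ra'h La'h'.
have /LnP[] := La'h'; rewrite negb_or => /andP[la' lh'] _.
have [lT|] := boolP (lw a h); first by apply/RpP; left.
rewrite negb_or => /andP[la lh].
have fl p q t : ~~ lwin G1 p -> ~~ lwin G2 q ->
    valU (swap G1) (swap G2) (flip p) (flip q) t = 2 - u p q (~~ t).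
  by move=> lp lq; rewrite -{1}[t]negbK valU_flip // negb_or lp.
have := @exchange _ _ (swap G1) (swap G2) (flip a) (flip a') (flip h) (flip h').
rewrite !fl // /=.
by move: Rah' Ra'h La'h'; lia.
Qed.

(** The last clause of [union_ge] at [k = 2], read for Right with the components exchanged. *)
Lemma union_le0 p q : valp G2 q true = 0 -> valp G1 p false <= 1 -> u p q false = 0.
Proof.
move=> q0 p1.
have lq : ~~ lwin G2 q.
  by apply/negP => lT; move: q0; rewrite /valp valueE -/(lwin G2 q) lT.
have lp : ~~ lwin G1 p.
  by apply/negP => lT; move: p1; rewrite /valp valueE -/(lwin G1 p) lT.
have [_ _] := @union_ge _ _ (swap G2) (swap G1) 2 (flip q) (flip p) isT.
rewrite -[false]/(~~ true) -[true]/(~~ false) (valp_flip _ lp) (valp_flip _ lq) q0.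
rewrite valU_flip ?negb_or ?lq // {1}/valU value_unionC -/(valU _ _ _ _ _) /=.
by have := value_le2 (gunion G1 G2) (join p.1 q.1) (join p.2 q.2) false;
  rewrite -/(u p q false); lia.
Qed.

Section Minimal.

Variables (p : position T1) (q : position T2).
Hypotheses (Lpq : Ln p q) (Rpq : Rp p q).

(* In the language of combinatorial games, where u <= 1 for Left's (resp.
   u >= 1 for Right's) first move reads "<= 0" (resp. ">= 0"): g is what remains
   of a winning attack of Left after bypassing the reversible moves, that is,
   Right cannot bring g + q back to "<= 0" by a move in g. *)
Definition solidL g :=
  [&& #|frees g| < #|frees p|, 2 <= valp G1 g false, Rn g q
    & [forall y in frees g, ~~ Ln (addR g y) q]].

(** The mirror notion in the second component: Right wins [h] even as second player, and no move of
    Left in [h] brings [p + h] back to a sum that is [>= 0]. *)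
Definition solidR h :=
  [&& #|frees h| < #|frees q|, valp G2 h true == 0, Lp p h
    & [forall x in frees h, ~~ Rp p (addL h x)]].

Let nwin : [/\ ~~ lwin G1 p, ~~ lwin G2 q, ~~ rwin G1 p & ~~ rwin G2 q].
Proof.
case/LnP: Lpq; rewrite negb_or => /andP[lp lq] _.
case/RpP: Rpq => [|[]]; first by rewrite (negPf lp) (negPf lq).
by rewrite negb_or => /andP[].
Qed.

(** As [g] is solid, Right's good move in [g + q] lies in [q]. Among all [h] with the relevant
    properties of such a reply a smallest is taken, so that a reversible one could be shortened
    further. *)
Lemma solidL_answer g : solidL g -> exists2 h, solidR h & Ln g h.
Proof.
have [lp lq rp rq] := nwin.
case/and4P=> gp g2 Rgq /forall_inP gsolid.
have [lg _] : ~~ lwin G1 g /\ ~~ lwin G2 q.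
  by case/RnP: (Rgq); rewrite negb_or => /andP.
have rg : ~~ rwin G1 g.
  by case/geR: (g2) => // [|[]//]; rewrite -/(lwin G1 g) (negPf lg).
have fg := valp2R_notfull lg g2.
pose C h := [&& #|frees h| < #|frees q|, Lp p h & Ln g h].
have RpR y h : y \in frees h -> ~~ lwin G2 h -> Rp p h -> Lp p (addR h y).
  move=> yF lh /RpP[|[_ [_ al]]]; first by rewrite (negPf lp) (negPf lh).
  exact: al.
have [h0 Ch0] : exists h, C h.
  case/RnP: (Rgq) => _; rewrite (negPf rg) (negPf rq).
  case=> [//|f|[y yF Ly]|[y yF Ly]].
  - by move/eqP: f; rewrite addn_eq0 eqn0Ngt fg.
  - by have := gsolid y yF; rewrite Ly.
  - exists (addR q y); rewrite /C Ly andbT (frees_addR yF) ltnSn /=.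
    exact: RpR.
case: (arg_minnP (fun h => #|frees h|) Ch0) => h /and3P[hq Lph Lgh] hmin.
have /LnP[] := Lgh; rewrite negb_or => /andP[_ lh] _.
have rh : ~~ rwin G2 h.
  case/LpP: Lph => [|[]]; first by rewrite (negPf lp) (negPf lh).
  by rewrite negb_or => /andP[].
exists h => //; rewrite /solidR hq Lph /=; apply/andP; split.
  (* If Left did not lose [h] moving first, [union_ge] would make her win [g + h] moving first. *)
  rewrite -leqn0 leqNgt; apply/negP => h1.
  have [_ _] := @union_ge _ _ G1 G2 2 g h isT.
  by move/(_ g2 h1); rewrite ltnNge Lgh.
apply/forall_inP => x xF; apply/negP => Rpx.
have lhx : ~~ lwin G2 (addL h x).
  apply/negP => lT; have /RpP[] := Rpq.
    by rewrite (negPf lp) (negPf lq).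
  move=> _; case/LnP: Lgh => _; rewrite (negPf rg) (negPf rh) => -[//|[_ /(_ x xF)]].
  by case/RnP; rewrite lT orbT.
have : Rn g (addL h x).
  by case/LnP: Lgh => _; rewrite (negPf rg) (negPf rh) => -[//|[_]]; apply.
case/RnP=> _; rewrite (negPf rg) [rwin G2 _](negPf rh).
case=> [//|f|[y yF Ly]|[y yF Ly]].
- by move/eqP: f; rewrite addn_eq0 eqn0Ngt fg.
(* By [exchange] through [p], the move [y] would bring [g + q] back to a sum that is [<= 0], against
   the solidity of [g]. *)
- by have := gsolid y yF; rewrite (exchange Ly Lpq Rpx).
(* The moves [x] and [y] together give a candidate with two fewer free vertices, against
   minimality. *)
- have card2 : #|frees h| = #|frees (addR (addL h x) y)|.+2.
    by rewrite (frees_addL xF) (frees_addR yF).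
  have /hmin : C (addR (addL h x) y).
    rewrite /C Ly (RpR _ _ yF lhx Rpx) !andbT.
    by apply: leq_trans hq; rewrite card2 ltnS leqW.
  by rewrite card2 ltnNge leqnSn.
Qed.

(** The argument of [solidL_answer] with [union_le0] and [exchange_dual] in place of [union_ge] and
    [exchange]. *)
Lemma solidR_answer h : solidR h -> exists2 g, solidL g & Rp g h.
Proof.
have [lp lq rp rq] := nwin.
case/and4P=> hq /eqP h0 Lph /forall_inP hsolid.
have lh : ~~ lwin G2 h.
  by apply/negP => lT; move: h0; rewrite /valp valueE -/(lwin G2 h) lT.
have rh : ~~ rwin G2 h.
  case/LpP: (Lph) => [|[]]; first by rewrite (negPf lp) (negPf lh).
  by rewrite negb_or => /andP[].
have fh : 0 < #|frees h|.
  rewrite lt0n; apply/eqP => f; move: h0; rewrite /valp valueE -/(lwin G2 h).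
  by rewrite (negPf lh) -/(rwin G2 h) (negPf rh) -/(frees h) f.
pose C g := [&& #|frees g| < #|frees p|, Rn g q & Rp g h].
have LnL x g : x \in frees g -> ~~ rwin G1 g -> Ln g q -> Rn (addL g x) q.
  by move=> xF rg /LnP[_]; rewrite (negPf rg) (negPf rq) => -[//|[al _]]; apply: al.
have [g0 Cg0] : exists g, C g.
  case/LpP: (Lph) => [|[_]]; first by rewrite (negPf lp) (negPf lh).
  case=> [f|[x xF Rx]|[x xF Rx]].
  - by move/eqP: f; rewrite addn_eq0 andbC eqn0Ngt fh.
  - exists (addL p x); rewrite /C Rx andbT (frees_addL xF) ltnSn /=.
    exact: LnL.
  - by have := hsolid x xF; rewrite Rx.
case: (arg_minnP (fun g => #|frees g|) Cg0) => g /and3P[gp Rgq Rgh] gmin.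
have /RnP[] := Rgq; rewrite negb_or => /andP[lg _] _.
exists g => //; rewrite /solidL gp Rgq /=; apply/andP; split.
  rewrite ltnNge; apply/negP => g1.
  by move: Rgh; rewrite (union_le0 h0 g1).
apply/forall_inP => y yF; apply/negP => Ly.
have : Lp (addR g y) h.
  by case/RpP: Rgh => [|[_ [al _]]]; [rewrite (negPf lg) (negPf lh)|apply: al].
case/LpP=> [|[]]; first by rewrite [lwin G1 _](negPf lg) (negPf lh).
rewrite negb_or => /andP[rgy _] [f|[x xF Rx]|[x xF Rx]].
- by move/eqP: f; rewrite addn_eq0 andbC eqn0Ngt fh.
- have card2 : #|frees g| = #|frees (addL (addR g y) x)|.+2.
    by rewrite (frees_addR yF) (frees_addL xF).
  have /gmin : C (addL (addR g y) x).
    rewrite /C Rx (LnL _ _ xF rgy Ly) !andbT.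
    by apply: leq_trans gp; rewrite card2 ltnS leqW.
  by rewrite card2 ltnNge leqnSn.
- by have := hsolid x xF; rewrite (exchange_dual Rpq Rx Ly).
Qed.

(** A winning first move in [p] is a candidate. In a smallest candidate Right has no reversing move,
    since Left's winning answer to it would yield a smaller one. *)
Lemma solidL_exists : 2 <= valp G1 p true -> exists g, solidL g.
Proof.
have [lp lq rp rq] := nwin => p2.
have LnL x g : x \in frees g -> ~~ rwin G1 g -> Ln g q -> Rn (addL g x) q.
  by move=> xF rg /LnP[_]; rewrite (negPf rg) (negPf rq) => -[//|[al _]]; apply: al.
pose C g := [&& #|frees g| < #|frees p|, 2 <= valp G1 g false & Rn g q].
have [g0 Cg0] : exists g, C g.
  case/geL: p2 => // [|[_ [[]//|[x xF x2]]]]; first by rewrite -/(lwin G1 p) (negPf lp).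
  exists (addL p x); rewrite /C [2 <= _]x2 -/(frees p) (frees_addL xF) ltnSn /=.
  exact: LnL.
case: (arg_minnP (fun g => #|frees g|) Cg0) => g /and3P[gp g2 Rgq] gmin.
have /RnP[] := Rgq; rewrite negb_or => /andP[lg _] _.
exists g; rewrite /solidL gp g2 Rgq /=; apply/forall_inP => y yF; apply/negP => Ly.
case/geR: g2 => // [|[_ [_ /(_ y yF)]]]; first by rewrite -/(lwin G1 g) (negPf lg).
case/geL => // [|[ry [[]//|[x xF x2]]]]; first by rewrite -/(lwin G1 g) (negPf lg).
have card2 : #|frees g| = #|frees (addL (addR g y) x)|.+2.
  by rewrite (frees_addR yF) (@frees_addL _ (addR g y) x).
have /gmin : C (addL (addR g y) x).
  rewrite /C [2 <= _]x2 (LnL x (addR g y)) //= andbT.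
  by apply: leq_trans gp; rewrite card2 ltnS leqW.
by rewrite card2 ltnNge leqnSn.
Qed.

End Minimal.

(* The relation "g + h <= 0 <= g' + h for some h" refines the preorder defined by
   inclusion of the sets [above g].  From a solid g the answers of Right and then
   of Left lead to such a g', so if g is maximal then g + h is itself a draw. *)
Lemma union_draw p q : Ln p q -> Rp p q -> valp G1 p true <= 1.
Proof.
have [n] := ubnP (#|frees p| + #|frees q|).
elim: n p q => // n IHn p q /ltnSE ltn Lpq Rpq.
rewrite leqNgt; apply/negP => p2.
have [g0 Sg0] := solidL_exists Lpq Rpq p2.
pose above g := [set h | Rp g h].
case: (arg_maxnP (fun g => #|above g|) Sg0) => g Sg gmax.
have [h Sh Lgh] := solidL_answer Lpq Rpq Sg.
have [g' Sg' Rgh'] := solidR_answer Lpq Rpq Sh.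
have sub : above g \subset above g'.
  by apply/subsetP => h2; rewrite !inE => Rgh2; apply: exchange_dual Rgh' Rgh2 Lgh.
have /eqP E : above g == above g' by rewrite eqEcard sub; apply: gmax.
(* [h] lies in [above g'], hence in [above g]; with [Lgh] this makes [g + h] a draw. *)
have Rgh : Rp g h by move/setP/(_ h): E; rewrite !inE Rgh'.
case/and4P: Sg Sh => gp g2 _ _ /and4P[hq _ _ _].
suff : valp G1 g true <= 1 by rewrite leqNgt (leq_trans g2) // value_first.
apply: IHn Lgh Rgh; apply: leq_trans ltn.
by rewrite -addnS; apply: leq_add (ltnW gp) hq.
Qed.

End Draw.

(** * Outcomes and the rules they obey in unions *)

Definition nat_of_result r := match r with RightWins => 0 | Draw => 1 | LeftWins => 2 end.
Definition dual_result r :=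
  match r with RightWins => LeftWins | Draw => Draw | LeftWins => RightWins end.
(** The entries also change places, because the starting player is exchanged too. *)
Definition dual (X : outcome) : outcome := (dual_result X.2, dual_result X.1).

Lemma nat_of_resultK : cancel nat_of_result result_of_score.
Proof. by case. Qed.

Lemma result_of_scoreK n : n <= 2 -> nat_of_result (result_of_score n) = n.
Proof. by case: n => [|[|[]]]. Qed.

Lemma dualK : involutive dual.
Proof. by case=> [[] []]. Qed.

Definition start (T : finType) (G : apg T) lt := value G set0 set0 lt.

Lemma play_resultE (T : finType) (G : apg T) lt :
  play_result G lt = result_of_score (start G lt).
Proof.
by congr result_of_score; apply: score_fuel => //; rewrite max_card.
Qed.

Lemma play_resultK (T : finType) (G : apg T) lt :
  nat_of_result (play_result G lt) = start G lt.
Proof. by rewrite play_resultE result_of_scoreK ?value_le2. Qed.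

Lemma blue_filled0 (T : finType) (G : apg T) : blue_filled G set0 = (set0 \in blue G).
Proof.
apply/existsP/idP => [[e]|eG]; last by exists set0; rewrite eG sub0set.
by rewrite subset0 => /andP[eG /eqP <-].
Qed.

Lemma start_swap (T : finType) (G : apg T) lt : wf_apg G ->
  start (swap G) (~~ lt) = 2 - start G lt.
Proof. by case/andP=> bG _; apply: value_swap; rewrite blue_filled0 (negPf bG). Qed.

Lemma o_swap (T : finType) (G : apg T) : wf_apg G -> o (swap G) = dual (o G).
Proof.
move=> wG; have := start_swap true wG; have := start_swap false wG.
rewrite /o !play_resultE /= => -> ->; rewrite /dual /=.
have := value_le2 G set0 set0 true; have := value_le2 G set0 set0 false.
by rewrite -!/(start G _); case: (start G _) => [|[|[|]]] // _; case: (start G _) => [|[|[|]]].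
Qed.

Lemma wf_gunion (T1 T2 : finType) (G1 : apg T1) (G2 : apg T2) :
  wf_apg G1 -> wf_apg G2 -> wf_apg (gunion G1 G2).
Proof.
have im0 (T T' : finType) (f : T -> T') (E : {set {set T}}) :
    set0 \notin E -> set0 \notin [set f @: (e : {set T}) | e in E].
  apply: contra => /imsetP[e eE e0]; suff <- : e = set0 by [].
  apply/setP => x; rewrite inE; apply/negP => xe.
  by have := imset_f f xe; rewrite -e0 inE.
by case/andP=> b1 r1 /andP[b2 r2]; rewrite /wf_apg !in_setU !negb_or !im0.
Qed.

Lemma start_gunion (T1 T2 : finType) (G1 : apg T1) (G2 : apg T2) lt :
  start (gunion G1 G2) lt = valU G1 G2 (set0, set0) (set0, set0) lt.
Proof. by rewrite /valU !join0. Qed.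

Lemma S_sym X Y Z : S X Y Z -> S Y X Z.
Proof.
case=> [T1 [T2 [G1 [G2 [w1 w2 oX oY <-]]]]]; exists T2, T1, G2, G1; split=> //.
by rewrite /o !play_resultE !start_gunion /valU; congr pair; rewrite value_unionC.
Qed.

Lemma S_dual X Y Z : S X Y Z -> S (dual X) (dual Y) (dual Z).
Proof.
case=> [T1 [T2 [G1 [G2 [w1 w2 <- <- <-]]]]]; exists T1, T2, (swap G1), (swap G2).
have wS T (G : apg T) : wf_apg G -> wf_apg (swap G) by rewrite /wf_apg andbC.
by split; rewrite ?wS -?o_swap ?wf_gunion.
Qed.

Lemma S_dualE X Y Z : S (dual X) (dual Y) (dual Z) -> S X Y Z.
Proof. by move/S_dual; rewrite !dualK. Qed.

(** A decidable form of what is known about a union: moving first is no disadvantage, then the three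
    bounds of [union_ge], then [union_draw]. These concern Left and the first component;
    [compatible] adds the symmetric versions. *)
Definition rules (X Y Z : outcome) :=
  let l (X : outcome) := nat_of_result X.1 in
  let r (X : outcome) := nat_of_result X.2 in
  [&& r Z <= l Z,
      all (fun k => [&& (k <= r X) && (0 < r Y) ==> (k <= r Z),
                        (k <= l X) && (0 < r Y) ==> (k <= l Z)
                      & (k <= r X) && (0 < l Y) ==> (k <= l Z)]) [:: 1; 2]
    & (l Z <= 1) && (0 < r Z) ==> (l X <= 1)].

Lemma S_rules X Y Z : S X Y Z -> rules X Y Z.
Proof.
case=> [T1 [T2 [G1 [G2 [_ _ <- <- <-]]]]].
rewrite /rules !play_resultK !start_gunion valU_first /=.
have [R1 L1 M1] := @union_ge _ _ G1 G2 1 (set0, set0) (set0, set0) isT.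
have [R2 L2 M2] := @union_ge _ _ G1 G2 2 (set0, set0) (set0, set0) isT.
rewrite andbT; apply/andP; split.
  by apply/andP; split; apply/and3P; split; apply/implyP => /andP[].
apply/implyP => /andP[]; exact: union_draw.
Qed.

Definition compatible X Y Z :=
  [&& rules X Y Z, rules Y X Z, rules (dual X) (dual Y) (dual Z)
    & rules (dual Y) (dual X) (dual Z)].

Lemma S_compatible X Y Z : S X Y Z -> compatible X Y Z.
Proof.
move=> h; have h' := S_sym h.
by apply/and4P; split; apply: S_rules => //; apply: S_dual.
Qed.

(** * A sound game search on lists of numbers *)

Section Evaluation.

Definition board := seq (seq nat).

Definition occupy v (E : board) : board := [seq [seq x <- e | x != v] | e <- E].
Definition discard v (E : board) : board := [seq e <- E | v \notin e].

(** Explicit conditionals let call-by-value evaluation stop at the first success. *)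
Fixpoint anyb (f : nat -> bool) s :=
  if s is v :: s' then if f v then true else anyb f s' else false.

Fixpoint allb (f : nat -> bool) s :=
  if s is v :: s' then if f v then allb f s' else false else true.

Lemma anybP f s : anyb f s -> exists2 v, v \in s & f v.
Proof.
elim: s => //= v s IHs; case: ifP => [fv _|_ /IHs[w ws fw]].
  by exists v; rewrite ?mem_head.
by exists w; rewrite // in_cons ws orbT.
Qed.

Lemma allbP f s : allb f s -> forall v, v \in s -> f v.
Proof.
elim: s => //= v s IHs; case: ifP => // fv /IHs al w.
by rewrite in_cons => /predU1P[->|/al].
Qed.

Definition forced (E : board) := flatten [seq e <- E | size e == 1].

(* E and F are the blue and red edges not hit by the opponent of their owner,
   restricted to the free vertices fr.  Sound but incomplete: only forced moves
   are tried when there are any, and otherwise moves are tried in the order of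
   fr, which is tuned to keep the search small. *)
Fixpoint ensures n k (E F : board) (fr : seq nat) lt : bool :=
  if [::] \in E then true
  else if [::] \in F then false
  else if (k == 1) && nilp F then true
  else if n is n'.+1 then
    if nilp fr then k == 1
    else if lt then
      let moves := if forced E is v :: _ then [:: v]
                   else if forced F is v :: _ then [:: v] else fr in
      anyb (fun v => if v \in fr
        then ensures n' k (occupy v E) (discard v F) [seq u <- fr | u != v] false
        else false) moves
    else if nilp (forced F) then
      allb (fun v => ensures n' k (discard v E) (occupy v F) [seq u <- fr | u != v] true) fr
    else false
  else false.

Variables (T : finType) (G : apg T) (lab : T -> nat).
Hypothesis lab_inj : injective lab.
Implicit Types (A B : {set T}) (E F : board) (fr : seq nat).

(** Only the direction needed for a lower bound is recorded: filling a listed blue edge really fills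
    an edge, whereas in [red_board] every red edge still open to Right must be represented. *)
Definition blue_board A B E := forall e, e \in E -> exists2 X, X \in blue G &
  [disjoint X & B] /\ forall x, x \in X -> x \notin A -> lab x \in e.

Definition red_board A B F := forall X, X \in red G -> [disjoint X & A] ->
  exists2 e, e \in F & forall v, v \in e -> exists x, [/\ x \in X, lab x = v & x \notin B].

Definition free_labels A B fr := forall v, reflect
  (exists2 x, x \in free A B & lab x = v) (v \in fr).

Lemma disjoint_add (X A : {set T}) x : [disjoint X & x |: A] = (x \notin X) && [disjoint X & A].
Proof.
by rewrite [RHS]andbC [LHS]disjoint_sym [X in X && _]disjoint_sym -setI_eq0 setIUl setU_eq0
  !setI_eq0 disjoints1 andbC.
Qed.

Lemma free_labels_rem A B A' B' x fr : free A' B' = free A B :\ x ->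
  free_labels A B fr -> free_labels A' B' [seq u <- fr | u != lab x].
Proof.
move=> fE ok v; rewrite mem_filter.
apply: (iffP andP) => [[vx /ok[y yF yv]]|[y]].
  exists y => //; rewrite fE in_setD1 yF andbT.
  by apply: contraNneq vx => <-; rewrite yv.
rewrite fE in_setD1 => /andP[yx yF] <-; split; first by rewrite (inj_eq lab_inj).
by apply/ok; exists y.
Qed.

(** This justifies the cut-off of the search at [k = 1]: once Left has hit every red edge, Right can
    never fill one. *)
Lemma red_blocked A B lt : [disjoint A & B] ->
  (forall X, X \in red G -> ~~ [disjoint X & A]) -> 1 <= value G A B lt.
Proof.
have [n] := ubnP #|free A B|; elim: n A B lt => // n IHn A B lt /ltnSE ltn dAB blk.
have rB : ~~ red_filled G B.
  apply/existsP => -[X /andP[/blk + XB]]; rewrite -setI_eq0 => /set0Pn[x].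
  rewrite inE => /andP[/(subsetP XB) xB xA].
  by move/pred0P/(_ x): dAB; rewrite /= xA xB.
have next x : x \in free A B ->
    (1 <= value G (x |: A) B false) && (1 <= value G A (x |: B) true).
  move=> xF; have [xA xB] := free_notin xF.
  apply/andP; split; apply: IHn.
  - by rewrite -(card_free_left xF).
  - by rewrite disjoint_sym disjoint_add xB disjoint_sym.
  - by move=> X /blk; apply: contra; rewrite disjoint_add => /andP[].
  - by rewrite -(card_free_right xF).
  - by rewrite disjoint_add xA.
  - exact: blk.
case: lt.
  apply/geL => //; right; split=> //.
  have [->|/set0Pn[x xF]] := eqVneq (free A B) set0; first by left; rewrite cards0.
  by right; exists x => //; case/andP: (next x xF).
by apply/geR => //; right; split=> //; split=> // x /next/andP[].
Qed.

(** Soundness by induction on the depth: picking a vertex preserves the three invariants linking the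
    lists to the position. *)
Lemma ensuresP n k E F fr A B lt : 0 < k <= 2 -> [disjoint A & B] ->
  blue_board A B E -> red_board A B F -> free_labels A B fr ->
  ensures n k E F fr lt -> k <= value G A B lt.
Proof.
move=> k12; elim: n E F fr A B lt => [|n IHn] E F fr A B lt dAB okE okF okfr /=.
(* The terminal tests are common to depth zero and to the inductive step. *)
all: case: ifP => [/okE[X XG [_ XA]] _|_].
1,3: have lA : blue_filled G A.
1,3: apply/existsP; exists X; rewrite XG; apply/subsetP => x xX.
1,2: by apply/negPn/negP => /(XA x xX).
1,2: by case: lt; [apply/geL|apply/geR] => //; left.
all: case: ifP => // nF.
all: have rB : ~~ red_filled G B.
1,3: apply/existsP => -[X /andP[XG XB]].
1,2: have dXA : [disjoint X & A] by apply: disjointWl XB _; rewrite disjoint_sym.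
1,2: have [[|v e] eF ev] := okF X XG dXA; first by rewrite eF in nF.
1,2: by have [x [xX _ /negP[]]] := ev v (mem_head _ _); apply: (subsetP XB).
all: case: ifP => [/andP[/eqP k1 /nilP F0] _|_ //].
1,2: rewrite k1; apply: red_blocked => // X XG; apply/negP => /(okF X XG)[e].
1,2: by rewrite F0.
have stepR x : x \in free A B ->
    ensures n k (discard (lab x) E) (occupy (lab x) F) [seq u <- fr | u != lab x] true ->
    k <= value G A (x |: B) true.
  move=> xF; have [xA xB] := free_notin xF.
  apply: IHn; rewrite ?disjoint_add ?xA //.
  - move=> e; rewrite mem_filter => /andP[xe /okE[X XG [dXB XA]]]; exists X => //.
    by rewrite disjoint_add dXB andbT; split=> //; apply: contra xe => xX; apply: XA.
  - move=> X XG dXA; have [e eF ev] := okF X XG dXA.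
    exists [seq u <- e | u != lab x]; first exact: map_f.
    move=> v; rewrite mem_filter => /andP[vx /ev[y [yX yv yB]]]; exists y; split=> //.
    rewrite in_setU1 negb_or yB andbT; apply: contraNneq vx => <-; by rewrite yv.
  - by apply: free_labels_rem okfr; rewrite free_right.
have stepL x : x \in free A B ->
    ensures n k (occupy (lab x) E) (discard (lab x) F) [seq u <- fr | u != lab x] false ->
    k <= value G (x |: A) B false.
  move=> xF; have [xA xB] := free_notin xF.
  apply: IHn; rewrite ?[_ _ (mem B)]disjoint_sym ?disjoint_add ?xB 1?disjoint_sym //.
  - move=> _ /mapP[e eE ->]; have [X XG [dXB XA]] := okE e eE; exists X => //.
    split=> // y yX; rewrite in_setU1 negb_or => /andP[yx yA].
    by rewrite mem_filter (inj_eq lab_inj) yx XA.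
  - move=> X XG; rewrite disjoint_add => /andP[xX dXA].
    have [e eF ev] := okF X XG dXA; exists e => //; rewrite mem_filter eF andbT.
    by apply: contra xX => /ev[y [yX /lab_inj<-]].
  - by apply: free_labels_rem okfr; rewrite free_left.
case: ifP => [/nilP fr0 /eqP k1|frN].
  have f0 : #|free A B| = 0.
    apply/eqP; rewrite cards_eq0; apply/set0Pn => -[x xF].
    by have : lab x \in fr by [apply/okfr; exists x]; rewrite fr0.
  case: lt; [apply/geL|apply/geR] => //; right; split=> //; first by left.
  by split=> // v; rewrite (cards0_eq f0) inE.
case: lt; last first.
  case: ifP => // _ /allbP al; apply/geR => //; right; split=> //; split=> [f0|x xF].
    case: fr frN okfr {al stepL stepR} => // v fr _ okfr.
    by have [x] := elimT (okfr v) (mem_head v fr); rewrite (cards0_eq f0) inE.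
  by apply: (stepR x xF); apply: (al (lab x)); apply/okfr; exists x.
case/anybP=> v _; case: ifP => // /okfr[x xF <-] /(stepL x xF) kx.
by apply: (geL_free k12 rB xF).
Qed.

End Evaluation.

(** * From certified boards to games and their unions *)

Section Boards.

Definition well_formed n (E : board) :=
  all (fun e => ~~ nilp e && all (fun v => v < n) e) E.

Definition edges n (E : board) : {set {set 'I_n}} :=
  [set X in [seq [set i : 'I_n | val i \in e] | e <- E]].

Definition board_game n (EF : board * board) : apg 'I_n := APG (edges n EF.1) (edges n EF.2).

Lemma wf_board_game n EF : well_formed n EF.1 -> well_formed n EF.2 -> wf_apg (board_game n EF).
Proof.
have no0 E : well_formed n E -> set0 \notin edges n E.
  move=> /allP wfE; rewrite inE; apply/mapP => -[e /wfE/andP[eN /allP en]].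
  case: e eN en => // v e _ en /setP; have vn := en v (mem_head v e).
  by move/(_ (Ordinal vn)); rewrite !inE eqxx.
by move=> wE wF; rewrite /wf_apg !no0.
Qed.

(** The search gives lower bounds only; the upper bound [k] is the lower bound [2 - k] for the game
    with colours and turn exchanged. *)
Definition exact_score N (EF : board * board) fr lt k :=
  ((k == 0) || ensures N k EF.1 EF.2 fr lt) &&
  ((k == 2) || ensures N (2 - k) EF.2 EF.1 fr (~~ lt)).

(** The arbitrary injective labelling makes this apply both to a single board and to a union, whose
    vertices form a sum type. *)
Lemma exact_scoreP (T : finType) (G : apg T) (lab : T -> nat) N (EF : board * board)
    (fr : seq nat) lt k :
  injective lab -> wf_apg G -> k <= 2 ->
  (forall v, reflect (exists x, lab x = v) (v \in fr)) ->
  blue G = [set X in [seq [set x | lab x \in e] | e <- EF.1]] ->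
  red G = [set X in [seq [set x | lab x \in e] | e <- EF.2]] ->
  (forall (e : seq nat) v, e \in EF.1 ++ EF.2 -> v \in e -> exists x, lab x = v) ->
  exact_score N EF fr lt k -> start G lt = k.
Proof.
move=> lab_inj wG k2 okfr bG rG labE.
have okB (G' : apg T) (E : board) : blue G' = [set X in [seq [set x | lab x \in e] | e <- E]] ->
    blue_board G' lab set0 set0 E.
  move=> bG' e eE; exists [set x | lab x \in e].
    by rewrite bG' inE; apply: map_f.
  by rewrite disjoint_sym disjoints_subset sub0set; split=> // x; rewrite inE.
have okR (G' : apg T) (F : board) : red G' = [set X in [seq [set x | lab x \in e] | e <- F]] ->
    {subset F <= EF.1 ++ EF.2} -> red_board G' lab set0 set0 F.
  move=> rG' sF X; rewrite rG' inE => /mapP[e eF ->] _; exists e => // v ve.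
  by have [x xv] := labE e v (sF e eF) ve; exists x; rewrite !inE xv.
have okF : free_labels lab set0 set0 fr.
  move=> v; apply: (iffP (okfr v)) => [[x]|[x]]; exists x => //.
  by rewrite freeE !inE.
have d0 : [disjoint (set0 : {set T}) & (set0 : {set T})].
  by rewrite disjoints_subset sub0set.
have s1 : {subset EF.1 <= EF.1 ++ EF.2} by move=> e; rewrite mem_cat => ->.
have s2 : {subset EF.2 <= EF.1 ++ EF.2} by move=> e; rewrite mem_cat orbC => ->.
case/andP=> lo hi; apply/eqP; rewrite eqn_leq andbC; apply/andP; split.
  case: k k2 lo {hi} => // k k2 /= lo.
  exact: (ensuresP lab_inj _ d0 (okB _ _ bG) (okR _ _ rG s2) okF lo).
move: hi; case: eqP => [-> _|kN2 /= hi]; first exact: value_le2.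
have : 2 - k <= start (swap G) (~~ lt).
  by apply: (ensuresP lab_inj _ d0 (okB (swap G) _ rG) (okR (swap G) _ bG s1) okF hi); lia.
by rewrite start_swap //; have := value_le2 G set0 set0 lt; rewrite -/(start G lt); lia.
Qed.

Definition exact_outcome N EF fr (X : outcome) :=
  exact_score N EF fr true (nat_of_result X.1) && exact_score N EF fr false (nat_of_result X.2).

Lemma nat_of_result_le2 r : nat_of_result r <= 2.
Proof. by case: r. Qed.

Lemma outcomeP (T : finType) (G : apg T) X :
  (forall lt, start G lt = nat_of_result (if lt then X.1 else X.2)) -> o G = X.
Proof.
by case: X => r1 r2 sE; rewrite /o !play_resultE !sE !nat_of_resultK.
Qed.

Lemma board_outcome n EF X : well_formed n EF.1 -> well_formed n EF.2 ->
  exact_outcome n EF (iota 0 n) X -> o (board_game n EF) = X.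
Proof.
move=> w1 w2 /andP[e1 e2]; apply: outcomeP => lt.
apply: (@exact_scoreP _ _ (@nat_of_ord n) n EF (iota 0 n)) => //.
- exact: val_inj.
- exact: wf_board_game.
- exact: nat_of_result_le2.
- move=> v; rewrite mem_iota add0n leq0n /=; apply: (iffP idP) => [vn|[i <-]] //.
  by exists (Ordinal vn).
- move=> e v; rewrite mem_cat => /orP[/(allP w1)|/(allP w2)] /andP[_ /allP en] /en vn;
  by exists (Ordinal vn).
- by case: lt.
Qed.

Definition shift n (E : board) : board := [seq [seq n + v | v <- e] | e <- E].
Definition sum_board n1 (EF1 EF2 : board * board) : board * board :=
  (EF1.1 ++ shift n1 EF2.1, EF1.2 ++ shift n1 EF2.2).

Definition sum_label n1 n2 (x : 'I_n1 + 'I_n2) : nat :=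
  match x with inl i => i | inr j => n1 + j end.

Lemma sum_label_inj n1 n2 : injective (@sum_label n1 n2).
Proof.
move=> [i|i] [j|j] /= => [/val_inj->|E|E|/addnI/val_inj->] //.
  by have := ltn_ord i; rewrite E ltnNge leq_addr.
by have := ltn_ord j; rewrite -E ltnNge leq_addr.
Qed.

(** The bound on the labels in [E1] keeps them apart from the shifted labels of the second board. *)
Lemma edges_union n1 n2 (E1 E2 : board) : well_formed n1 E1 ->
  [set (@inl 'I_n1 'I_n2) @: (e : {set 'I_n1}) | e in edges n1 E1] :|:
  [set (@inr 'I_n1 'I_n2) @: (e : {set 'I_n2}) | e in edges n2 E2] =
  [set X in [seq [set x | @sum_label n1 n2 x \in e] | e <- E1 ++ shift n1 E2]].
Proof.
move=> /allP w1.
have imL (e : seq nat) : e \in E1 -> (@inl 'I_n1 'I_n2) @: [set i : 'I_n1 | val i \in e] =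
    [set x | @sum_label n1 n2 x \in e].
  move=> /w1/andP[_ /allP en]; apply/setP => -[i|j]; rewrite inE /=.
    by rewrite mem_imset ?inE //; apply: inl_inj.
  rewrite (_ : _ \in e = false); first by apply/imsetP => -[].
  by apply/negP => /en; rewrite ltnNge leq_addr.
have imR (e : seq nat) : (@inr 'I_n1 'I_n2) @: [set i : 'I_n2 | val i \in e] =
    [set x | @sum_label n1 n2 x \in [seq n1 + v | v <- e]].
  apply/setP => -[i|j]; rewrite inE /=.
    transitivity false; first by apply/imsetP => -[].
    by apply/esym/mapP => -[v _ iv]; have := ltn_ord i; rewrite iv ltnNge leq_addr.
  by rewrite mem_imset ?inE ?mem_map //; [apply: addnI|apply: inr_inj].
apply/setP => X; rewrite in_setU inE map_cat mem_cat; congr orb.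
  apply/imsetP/mapP => [[Y]|[e eE ->]].
    by rewrite inE => /mapP[e eE ->] ->; exists e; rewrite ?imL.
  by exists [set i : 'I_n1 | val i \in e]; rewrite ?imL // inE; apply: map_f.
rewrite /shift -map_comp; apply/imsetP/mapP => [[Y]|[e eE ->]].
  by rewrite inE => /mapP[e eE ->] ->; exists e; rewrite ?imR.
by exists [set i : 'I_n2 | val i \in e]; rewrite ?imR // inE; apply: map_f.
Qed.

(** A boolean certificate for one element of [S X Y]; [fr] is the order in which the search tries
    the vertices of the union. *)
Definition realizes n1 EF1 n2 EF2 fr X Y Z :=
  [&& well_formed n1 EF1.1, well_formed n1 EF1.2, well_formed n2 EF2.1, well_formed n2 EF2.2,
      perm_eq fr (iota 0 (n1 + n2)), exact_outcome n1 EF1 (iota 0 n1) X,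
      exact_outcome n2 EF2 (iota 0 n2) Y
    & exact_outcome (n1 + n2) (sum_board n1 EF1 EF2) fr Z].

Lemma realizesP n1 EF1 n2 EF2 fr X Y Z : realizes n1 EF1 n2 EF2 fr X Y Z -> S X Y Z.
Proof.
case/and5P=> b1 r1 b2 r2 /and4P[frE oX oY /andP[eZ1 eZ2]].
exists 'I_n1, 'I_n2, (board_game n1 EF1), (board_game n2 EF2).
split; [exact: wf_board_game|exact: wf_board_game|exact: board_outcome|exact: board_outcome|].
apply: outcomeP => lt.
apply: (@exact_scoreP _ _ (@sum_label n1 n2) (n1 + n2) (sum_board n1 EF1 EF2) fr).
- exact: sum_label_inj.
- by apply: wf_gunion; apply: wf_board_game.
- exact: nat_of_result_le2.
- move=> v; rewrite (perm_mem frE) mem_iota add0n leq0n /=; apply: (iffP idP) => [vn|[[i|j] <-]] /=.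
  + have [v1|v1] := ltnP v n1; first by exists (inl (Ordinal v1)).
    have v2 : v - n1 < n2 by rewrite ltn_subLR.
    by exists (inr (Ordinal v2)); rewrite /= subnKC.
  + by rewrite ltn_addr.
  + by rewrite ltn_add2l.
- exact: edges_union.
- exact: edges_union.
- have lab1 (E : board) (e : seq nat) v : well_formed n1 E -> e \in E -> v \in e ->
      exists x, @sum_label n1 n2 x = v.
    by move=> /allP wE /wE/andP[_ /allP en] /en vn; exists (inl (Ordinal vn)).
  have lab2 (E : board) (e : seq nat) v : well_formed n2 E -> e \in shift n1 E -> v \in e ->
      exists x, @sum_label n1 n2 x = v.
    move=> /allP wE /mapP[d /wE/andP[_ /allP dn] ->] /mapP[w /dn wn ->].
    by exists (inr (Ordinal wn)).
  move=> e v; rewrite /= !mem_cat -!orbA => /or4P[] eE ve.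
  + exact: lab1 b1 eE ve.
  + exact: lab2 b2 eE ve.
  + exact: lab1 r1 eE ve.
  + exact: lab2 r2 eE ve.
- by case: lt.
Qed.

End Boards.

(** * Explicit unions attaining the allowed outcomes *)

Ltac realize n1 EF1 n2 EF2 fr :=
  apply: (@realizesP n1 EF1 n2 EF2 fr); vm_cast_no_check (erefl true).

Ltac realize_iota n1 EF1 n2 EF2 :=
  apply: (@realizesP n1 EF1 n2 EF2 (iota 0 (n1 + n2))); vm_cast_no_check (erefl true).

Definition boardL : board * board := ([:: [:: 0]; [:: 1]], [::]).
Definition boardLm : board * board := ([:: [:: 0]], [::]).
Definition boardN : board * board := ([:: [:: 0]], [:: [:: 0]]).
Definition boardD : board * board := ([::], [::]).
(** Moving first, the owner takes 2 and has a double threat; the opponent, moving first, destroys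
    both edges at 2. *)
Definition fork : board := [:: [:: 0; 2]; [:: 1; 2]].
(** A four-cycle: after any first move of the opponent a fork remains, so the owner wins even as
    second player. *)
Definition square : board := [:: [:: 0; 2]; [:: 1; 2]; [:: 0; 3]; [:: 1; 3]].

(* If Right spends his first move on 0, Left answers 3 and then owns a slow but
   certain win: one of 1, 2, one of 4, 5 and one of 6, 7. *)
Definition slowL : board * board :=
  ([:: [:: 0; 1]; [:: 0; 2]; [:: 3; 1; 4; 6]; [:: 3; 1; 4; 7]; [:: 3; 1; 5; 6];
       [:: 3; 1; 5; 7]; [:: 3; 2; 4; 6]; [:: 3; 2; 4; 7]; [:: 3; 2; 5; 6];
       [:: 3; 2; 5; 7]], [::]).
(** All edges pass through 4, where Left can destroy them at once. Once he owns 4, Right gets one of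
    0, 3 and one of 1, 2 by pairing, even with Left to move. *)
Definition slowRm : board * board :=
  ([::], [:: [:: 4; 0; 1]; [:: 4; 0; 2]; [:: 4; 3; 1]; [:: 4; 3; 2]]).
(* Found by computer search. *)
Definition slowN : board * board :=
  ([:: [:: 1; 3]; [:: 1; 5]],
   [:: [:: 1; 2]; [:: 0; 2; 3]; [:: 0; 1; 4]; [:: 0; 3; 5]; [:: 3; 4; 6]; [:: 1; 3; 5; 6]]).

Lemma S_L_L_L : S oL oL oL. Proof. realize_iota 2 boardL 2 boardL. Qed.
Lemma S_L_Lm_L : S oL oLm oL. Proof. realize_iota 2 boardL 1 boardLm. Qed.
Lemma S_L_D_L : S oL oD oL. Proof. realize_iota 2 boardL 0 boardD. Qed.
Lemma S_Lm_D_Lm : S oLm oD oLm. Proof. realize_iota 1 boardLm 0 boardD. Qed.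
Lemma S_N_D_N : S oN oD oN. Proof. realize_iota 1 boardN 0 boardD. Qed.
Lemma S_D_D_D : S oD oD oD. Proof. realize_iota 0 boardD 0 boardD. Qed.

Lemma S_L_N_L : S oL oN oL.
Proof. realize_iota 2 boardL 3 ([:: [:: 2]] : board, fork). Qed.
Lemma S_L_N_N : S oL oN oN. Proof. realize_iota 2 boardL 1 boardN. Qed.
Lemma S_L_N_Lm : S oL oN oLm.
Proof. realize 8 slowL 7 slowN [:: 0; 9; 3; 11; 8; 4; 14; 13; 12; 5; 10; 1; 2; 6; 7]. Qed.

Lemma S_L_Rm_L : S oL oRm oL. Proof. realize_iota 2 boardL 3 ([::] : board, fork). Qed.
Lemma S_L_Rm_N : S oL oRm oN. Proof. realize_iota 2 boardL 1 ([::] : board, [:: [:: 0]] : board). Qed.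
(** If Right opens at 0, Left answers at 12, which is the vertex 4 of [slowRm] shifted by 8; Right
    then takes 3, and no edge of either colour can be filled. *)
Lemma S_L_Rm_Lm : S oL oRm oLm.
Proof. realize 8 slowL 5 slowRm [:: 0; 12; 3; 1; 2; 9; 4; 5; 10; 11; 8; 7; 6]. Qed.

Lemma S_L_R_L : S oL oR oL. Proof. realize_iota 2 boardL 4 ([::] : board, square). Qed.
Lemma S_L_R_N : S oL oR oN. Proof. realize_iota 2 boardL 2 (boardL.2, boardL.1). Qed.
(* Right has to open with the vertex 5, and then Left faces the mirror image of
   S_L_Rm_Lm. *)
Lemma S_L_R_Lm : S oL oR oLm.
Proof.
realize 6 ([:: 5] :: slowRm.2, [::] : board) 8 (slowL.2, slowL.1)
  [:: 4; 6; 9; 10; 11; 0; 8; 7; 3; 1; 2; 5; 13; 12].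
Qed.

Lemma S_Lm_Lm_L : S oLm oLm oL. Proof. realize_iota 1 boardLm 1 boardLm. Qed.
(** Right takes 0 and threatens the red edge; Left's forced reply at 1 gives him time to take the
    centre of the fork. *)
Lemma S_Lm_Lm_Lm : S oLm oLm oLm.
Proof. realize_iota 2 ([:: [:: 0]] : board, [:: [:: 0; 1]] : board) 3 (fork, [::] : board). Qed.

Lemma S_Lm_N_L : S oLm oN oL. Proof. realize_iota 1 boardLm 3 ([:: [:: 2]] : board, fork). Qed.
Lemma S_Lm_N_N : S oLm oN oN. Proof. realize_iota 1 boardLm 1 boardN. Qed.
Lemma S_Lm_N_Lm : S oLm oN oLm.
Proof.
realize_iota 3 (fork, [::] : board) 5
  ([:: [:: 2; 3]; [:: 2; 4]] : board,
   [:: [:: 1; 3]; [:: 0; 2; 3]; [:: 0; 2; 4]; [:: 1; 2; 4]] : board).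
Qed.

Lemma S_Lm_Rm_Lm : S oLm oRm oLm. Proof. realize_iota 1 boardLm 3 ([::] : board, fork). Qed.
Lemma S_Lm_Rm_N : S oLm oRm oN. Proof. realize_iota 1 boardLm 1 (boardLm.2, boardLm.1). Qed.

Lemma S_N_N_L : S oN oN oL.
Proof. realize_iota 3 ([:: [:: 2]] : board, fork) 3 ([:: [:: 2]] : board, fork). Qed.
Lemma S_N_N_N : S oN oN oN. Proof. realize_iota 1 boardN 1 boardN. Qed.
(* Left has to open with the vertex 8, and then Right faces S_L_N_Lm. *)
Lemma S_N_N_Rm : S oN oN oRm.
Proof.
realize 9 (slowL.1, [:: [:: 8]] : board) 7 slowN
  [:: 0; 10; 3; 12; 9; 5; 15; 14; 13; 8; 4; 11; 2; 1; 6; 7].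
Qed.

(** * Assembly of the table *)

Ltac listed := first [
  exact: S_L_L_L |
  exact: S_L_Lm_L |
  exact: S_L_D_L |
  exact: S_Lm_D_Lm |
  exact: S_N_D_N |
  exact: S_D_D_D |
  exact: S_L_N_L |
  exact: S_L_N_N |
  exact: S_L_N_Lm |
  exact: S_L_Rm_L |
  exact: S_L_Rm_N |
  exact: S_L_Rm_Lm |
  exact: S_L_R_L |
  exact: S_L_R_N |
  exact: S_L_R_Lm |
  exact: S_Lm_Lm_L |
  exact: S_Lm_Lm_Lm |
  exact: S_Lm_N_L |
  exact: S_Lm_N_N |
  exact: S_Lm_N_Lm |
  exact: S_Lm_Rm_Lm |
  exact: S_Lm_Rm_N |
  exact: S_N_N_L |
  exact: S_N_N_N |
  exact: S_N_N_Rm ].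

(** The other entries follow from the listed ones by exchanging the players, the components or
    both. *)
Ltac attained := first [listed | apply: S_dualE; listed | apply: S_sym; listed
  | apply: S_dualE; apply: S_sym; listed].

(** Of the nine pairs of results, [compatible] rejects those outside the entry; each of the others
    is attained. *)
Ltac cell :=
  let Z := fresh "Z" in let h := fresh "h" in
  intro Z; split;
  [ case: Z => [[] []] /S_compatible; vm_compute => // _; auto 6
  | intro h; repeat (case: h => h); subst Z; attained ].

Theorem theorem4 :
  (forall X Y Z : outcome, S X Y Z <-> S Y X Z) /\
  (forall Z, S oL oL Z <-> Z = oL) /\
  (forall Z, S oL oLm Z <-> Z = oL) /\
  (forall Z, S oL oN Z <-> (Z = oL \/ Z = oLm \/ Z = oN)) /\
  (forall Z, S oL oD Z <-> Z = oL) /\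
  (forall Z, S oL oRm Z <-> (Z = oL \/ Z = oLm \/ Z = oN)) /\
  (forall Z, S oL oR Z <-> (Z = oL \/ Z = oLm \/ Z = oN \/ Z = oRm \/ Z = oR)) /\
  (forall Z, S oLm oLm Z <-> Z = oL \/ Z = oLm) /\
  (forall Z, S oLm oN Z <-> (Z = oL \/ Z = oLm \/ Z = oN)) /\
  (forall Z, S oLm oD Z <-> Z = oLm) /\
  (forall Z, S oLm oRm Z <-> (Z = oLm \/ Z = oN \/ Z = oRm)) /\
  (forall Z, S oLm oR Z <-> (Z = oN \/ Z = oRm \/ Z = oR)) /\
  (forall Z, S oN oN Z <-> (Z = oL \/ Z = oLm \/ Z = oN \/ Z = oRm \/ Z = oR)) /\
  (forall Z, S oN oD Z <-> Z = oN) /\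
  (forall Z, S oN oRm Z <-> (Z = oN \/ Z = oRm \/ Z = oR)) /\
  (forall Z, S oN oR Z <-> (Z = oN \/ Z = oRm \/ Z = oR)) /\
  (forall Z, S oD oD Z <-> Z = oD) /\
  (forall Z, S oD oRm Z <-> Z = oRm) /\
  (forall Z, S oD oR Z <-> Z = oR) /\
  (forall Z, S oRm oRm Z <-> Z = oRm \/ Z = oR) /\
  (forall Z, S oRm oR Z <-> Z = oR) /\
  (forall Z, S oR oR Z <-> Z = oR).
Proof.
split; first by move=> X Y Z; split; apply: S_sym.
repeat (split; first cell); cell.
Qed.
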